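(* Let $M$ be a compact Riemannian manifold without boundary, let $f:M\to M$ be a $C^1$ local diffeomorphism, and let $\mu$ be a non-atomic $f$-invariant ergodic Borel probability measure on $M$ such that all of the Lyapunov exponents of $f$ with respect to $\mu$ are positive. Then $f$ is positively $\mu$-expansive, i.e. there is a constant $\delta>0$ such that $\mu(\Gamma^+_\delta(f,x))=0$ for all $x\in M$.
   Context: $d$ denotes the distance on $M$ induced by the Riemannian metric $\|\cdot\|$. For $x\in M$ and $\delta>0$, $$\Gamma^+_\delta(f,x)=\{y\in M : d(f^n(x),f^n(y))\le \delta \text{ for all } n\in\mathbb{N}\},\qquad \mathbb N=\{0,1,2,\dots\}.$$ A Borel probability measure $\mu$ is atomic if there is a point $x\in M$ with $\mu(\{x\})>0$, and non-atomic otherwise. It is $f$-invariant if $\mu(f^{-1}(B))=\mu(B)$ for every measurable $B$. Lyapunov exponents: by Oseledets' theorem, for $\mu$-almost every $x\in M$ there are a $Df$-invariant measurable splitting $T_xM=E_1(x)\oplus\cdots\oplus E_{k(x)}(x)$ and numbers $\lambda_1(x)<\cdots<\lambda_{k(x)}(x)$ with $\lambda_i(x)=\lim_{n\to\infty}\frac1n\log\|Df^n(x)v\|$ for all $v\in E_i(x)\setminus\{0\}$. The numbers $\lambda_i(x)$ are the Lyapunov exponents of $f$ at $x$. ''All Lyapunov exponents are positive'' means $\lambda_i(x)>0$ for all $i$, for $\mu$-almost every $x$. *)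

(* Defs.v *)
From HB Require Import structures.
From mathcomp Require Import all_boot all_order all_algebra.
From mathcomp Require Import all_classical all_reals all_analysis.
Set Implicit Arguments.
Unset Strict Implicit.
Unset Printing Implicit Defensive.
Import Order.TTheory GRing.Theory Num.Theory.
Import numFieldNormedType.Exports.
Local Open Scope classical_set_scope.
Local Open Scope ring_scope.

(** ** C^k functions on open subsets of normed spaces *)

(** Meaningful for [U] open and finite-dimensional [V]; in dimension [n],
    continuity of [x |-> 'D_v f x] for each fixed [v] is continuity of the
    differential. *)
Fixpoint Ck (R : realType) (V W : normedModType R) (k : nat) (U : set V)
    (f : V -> W) : Prop :=
  match k with
  | 0%N => forall x, U x -> {for x, continuous f}
  | k'.+1 => (forall x, U x -> differentiable f x) /\
             (forall v, Ck k' U ('D_v f))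
  end.

(** ** Smooth manifolds without boundary

    The total functions [cmap] and [cinv] carry junk values off [cdom] and off
    [cmap @` cdom] respectively. *)
Record chart (R : realType) (n : nat) (M : topologicalType) := Chart {
  cdom : set M;
  cmap : M -> 'rV[R]_n;
  cinv : 'rV[R]_n -> M;
  cdom_open : open cdom;
  cimage_open : open (cmap @` cdom);
  cmapK : forall x, cdom x -> cinv (cmap x) = x;
  cmap_continuous : forall x, cdom x -> {for x, continuous cmap};
  cinv_continuous : forall y, (cmap @` cdom) y -> {for y, continuous cinv}
}.

(** [chart_at] selects a preferred chart around each point.  The tangent space
    T_xM is 'rV[R]_n, a tangent vector being given by its coordinates in
    [chart_at x].  No regularity of [x |-> chart_at x] is assumed, so every
    regularity condition on tensor fields below is expressed after transport
    to a fixed chart. *)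
Record smooth_atlas (R : realType) (n : nat) (M : topologicalType) :=
  SmoothAtlas {
  cidx : Type;
  charts : cidx -> chart R n M;
  chart_idx : M -> cidx;
  chart_idxP : forall x, cdom (charts (chart_idx x)) x;
  charts_compatible : forall (a b : cidx) (k : nat),
    Ck k (cmap (charts a) @` (cdom (charts a) `&` cdom (charts b)))
         (cmap (charts b) \o cinv (charts a))
}.

Section Manifold.
Variables (R : realType) (n : nat) (M : ptopologicalType).
Variable A : smooth_atlas R n M.

Definition chart_at (x : M) : chart R n M := charts (chart_idx A x).

(** Matrices of linear maps act on row vectors from the right, as for
    [jacobian]. *)
Definition coord_change (c d : chart R n M) (x : M) : 'M[R]_n :=
  jacobian (cmap d \o cinv c) (cmap c x).

(** [metric_mx x] is the Gram matrix, in [chart_at x], of the inner product of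
    T_xM. *)
Record riemannian_metric := RiemannianMetric {
  metric_mx : M -> 'M[R]_n;
  metric_sym : forall x, (metric_mx x)^T = metric_mx x;
  metric_pos : forall x (v : 'rV[R]_n), v != 0 ->
    0 < (v *m metric_mx x *m v^T) 0 0;
  metric_smooth : forall (a : cidx A) (k : nat),
    Ck k (cmap (charts a) @` cdom (charts a))
      (fun y => let x := cinv (charts a) y in
                let J := coord_change (charts a) (chart_at x) x in
                J *m metric_mx x *m J^T)
}.

(** ** C^1 maps and their tangent maps *)

Definition C1_map (U : set M) (f : M -> M) : Prop :=
  (forall x, U x -> {for x, continuous f}) /\
  (forall a b : cidx A,
    Ck 1 (cmap (charts a) @`
            (U `&` cdom (charts a) `&` f @^-1` cdom (charts b)))
         (cmap (charts b) \o f \o cinv (charts a))).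

Definition C1_local_diffeo (f : M -> M) : Prop :=
  forall x, exists U : set M, exists h : M -> M,
    [/\ open U, U x & open (f @` U)] /\
    [/\ (forall y, U y -> h (f y) = y), C1_map U f & C1_map (f @` U) h].

Definition tangent_map (f : M -> M) (x : M) : 'M[R]_n :=
  jacobian (cmap (chart_at (f x)) \o f \o cinv (chart_at x))
           (cmap (chart_at x) x).

(** ** Riemannian distance *)

Definition C1_curve (c : R -> M) : Prop :=
  continuous c /\
  forall a : cidx A,
    Ck 1 (c @^-1` cdom (charts a)) (cmap (charts a) \o c).

(** A C^1 curve on a compact interval is a restriction of a C^1 curve defined
    on the whole line. *)
Definition piecewise_C1 (c : R -> M) : Prop :=
  exists2 s : seq R, itv_partition 0 1 s &
    forall i, (i < size s)%N -> exists2 e : R -> M, C1_curve e &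
      {in `[nth 0 (0 :: s) i, nth 0 s i], c =1 e}.

Definition velocity (c : R -> M) (t : R) : 'rV[R]_n :=
  derive1 (cmap (chart_at (c t)) \o c) t.

Variable g : riemannian_metric.

Definition tnorm (x : M) (v : 'rV[R]_n) : R :=
  Num.sqrt ((v *m metric_mx g x *m v^T) 0 0).

(** The velocity has junk values at the finitely many break points. *)
Definition curve_length (c : R -> M) : \bar R :=
  (\int[lebesgue_measure]_(t in `[0%R, 1%R]) (tnorm (c t) (velocity c t))%:E)%E.

(** +oo between points of different components: M need not be connected. *)
Definition riemannian_dist (x y : M) : \bar R :=
  ereal_inf [set curve_length c | c in
    [set c : R -> M | [/\ piecewise_C1 c, c 0 = x & c 1 = y]]].

Definition Gamma_plus (f : M -> M) (delta : R) (x : M) : set M :=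
  [set y | forall m : nat,
     (riemannian_dist (iter m f x) (iter m f y) <= delta%:E)%E].

(** ** Measures *)

Definition borel : measurableType (@open M).-sigma :=
  g_sigma_algebraType (@open M).

Variable mu : probability borel R.

Definition atomic : Prop := exists x : M, (0 < mu [set x])%E.

Definition invariant_measure (f : M -> M) : Prop :=
  forall B : set borel, measurable B -> mu (f @^-1` B) = mu B.

Definition ergodic (f : M -> M) : Prop :=
  forall B : set borel, measurable B -> f @^-1` B = B ->
    mu B = 0%E \/ mu B = 1%E.

(** [Gamma_plus f delta x] is closed, hence Borel. *)
Definition positively_expansive (f : M -> M) : Prop :=
  exists2 delta : R, 0 < delta &
    forall x : M, mu (Gamma_plus f delta x) = 0%E.

(** ** Lyapunov exponents

    The splitting of T_xM is E x 0, ..., E x (k x - 1), each subspace being the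
    row space of a matrix written in [chart_at x]; values of [E x] and [lam x]
    at indices >= k x are irrelevant.  [transported_subspace] is the subspace
    in a fixed chart, and measurability of the subbundle is measurability of
    this subspace-valued map: the points whose subspace meets a given open set
    of vectors form a Borel set. *)
Definition transported_subspace (a : cidx A) (E : M -> nat -> 'M[R]_n)
    (i : nat) (x : M) : 'M[R]_n :=
  E x i *m coord_change (chart_at x) (charts a) x.

Definition oseledets_splitting (f : M -> M) (k : M -> nat)
    (E : M -> nat -> 'M[R]_n) (lam : M -> nat -> R) : Prop :=
  exists2 L : set borel, measurable L /\ mu L = 1%E &
    (forall x : M, L x ->
      [/\ (\sum_(i < k x) E x i :=: (1%:M : 'M[R]_n))%MS /\
          mxdirect (\sum_(i < k x) E x i)%MS,
          forall i, (i < k x)%N -> E x i != 0,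
          k (f x) = k x /\
          (forall i, (i < k x)%N ->
             (E x i *m tangent_map f x :=: E (f x) i)%MS),
          forall i j, (i < j)%N -> (j < k x)%N -> lam x i < lam x j &
          forall i (v : 'rV[R]_n), (i < k x)%N -> v != 0 -> (v <= E x i)%MS ->
            (fun m : nat =>
               m%:R^-1 * ln (tnorm (iter m f x)
                                   (v *m tangent_map (iter m f) x)))
            @ \oo --> lam x i]) /\
    (forall (a : cidx A) (i : nat) (W : set 'rV[R]_n), open W ->
      measurable (L `&` [set x : borel | [/\ cdom (charts a) x, (i < k x)%N &
        exists2 w, W w & (w <= transported_subspace a E i x)%MS]])).

Definition lyapunov_exponents_positive (f : M -> M) : Prop :=
  exists (k : M -> nat) (E : M -> nat -> 'M[R]_n) (lam : M -> nat -> R),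
    oseledets_splitting f k E lam /\
    {ae mu, forall x, forall i, (i < k x)%N -> 0 < lam x i}.

End Manifold.

(* Main.v *)
From HB Require Import structures.
Require Import Defs.
From mathcomp Require Import all_boot all_order all_algebra finmap.
From mathcomp Require Import all_classical all_reals all_analysis.
From mathcomp Require Import measurable_realfun.
From mathcomp Require Import ring lra zify.
Set Implicit Arguments.
Unset Strict Implicit.
Unset Printing Implicit Defensive.
Import Order.TTheory GRing.Theory Num.Theory.
Import numFieldNormedType.Exports.
Local Open Scope classical_set_scope.
Local Open Scope ring_scope.

(** Finitely many cut-off chart coordinates [u i] separate the points of M, and
    [sdist x y = \sum_i |u i x - u i y|] is bounded by a multiple of the
    Riemannian distance, so it suffices to separate orbits for [sdist].
    As all Lyapunov exponents of almost every x are positive, every tangent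
    vector at x is eventually expanded exponentially; by compactness of the unit
    sphere and differentiability of the iterates, x is then expanding: for some
    b > 1 and constants k, K, each y close to x has, at some time m <= K,
    sdist (f^m x) (f^m y) >= b^m sdist x y / k, and m may be required to be
    large.  The set of such points is Borel and backward invariant, hence of
    full measure for some b = c^2 with c > 1, and absorbing k into c^m gives
    points at which a factor c^m is gained within uniformly bounded time K on a
    ball of uniform size, except on a set B of small measure.
    By ergodicity and Markov's inequality almost every x has infinitely many
    times at which its orbit has made few visits to B.  At a visit, [sdist]
    shrinks at most by the local Lipschitz constant of the inverse of f, so the
    distance between the orbit of x and an orbit staying close to it would grow
    exponentially along these times.  Hence a set Y of full measure contains no
    point shadowed by another one.  A set [Gamma_plus] either misses Y or
    meets Y and is then a single point. *)

(** * Differential calculus and charts *)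

(** The Riemannian distance is extended-valued and is bounded above only by exhibiting curves, so
    the dynamics is studied with [sdist], which is finite, continuous and computable in charts. The
    Riemannian distance enters in two places: it controls [sdist] on [Gamma_plus], and its balls are
    open, which makes [Gamma_plus] Borel. The obstacle is that the exponents are approached at a
    speed depending on the point and on the tangent vector. Expansion is therefore recorded by
    [expansive_at b k n0 K x], whose failure at a given y means finitely many strict inequalities,
    so that it is a closed condition on x. The order of quantifiers matters: the loss k is fixed
    before the least time n0. Enlarging k pays for the passage to a preimage, whereas a large n0
    makes any fixed k negligible against the spare factor [c ^+ m] in the rate [c ^+ 2]. The
    admissible frequency of bad visits, about 1/q, is dictated by the inequality
    [2 * (L * c) <= c ^+ q], in which L is the global inverse Lipschitz constant. It involves
    neither K nor the bad set, so these can be chosen afterwards. *)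

Section Calculus.
Variable R : realType.

Lemma differentiable_le (V W : normedModType R) (f : V -> W) (x : V) :
  differentiable f x -> forall e : R, 0 < e ->
  \forall y \near x, `|f y - f x - 'd f x (y - x)| <= e * `|y - x|.
Proof.
move=> df e e0; have /diff_locally/eqaddoP := df => /(_ e e0).
rewrite (near_shift 0) /= subr0; apply: filterS => h /=.
by rewrite addrK -addrA -opprD.
Qed.

Lemma differentiable_near_eq (V W : normedModType R) (f g : V -> W) (x : V) :
  (\near x, f x = g x) -> differentiable f x ->
  differentiable g x /\ forall v, 'd g x v = 'd f x v.
Proof.
move=> fg df; have fgx : f x = g x by exact: nbhs_singleton fg.
have H : g \o shift x = cst (g x) + 'd f x +o_ 0 id.
  apply/eqaddoP => e e0.
  have := differentiable_le df e0.
  move: fg; rewrite !(near_shift 0 x) /= !subr0; apply: filterS2 => h /=.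
  by rewrite fgx addrK -addrA -opprD => ->.
have dg : 'd g x = 'd f x :> (V -> W) by apply: diff_unique => //; exact: diff_continuous.
split; last by move=> v; rewrite dg.
by apply/diff_locallyP; rewrite dg; split => //; exact: diff_continuous.
Qed.

Lemma differentiable_lipschitz_at (V W : normedModType R) (f : V -> W) (x : V) :
  differentiable f x ->
  exists2 c : R, 0 < c & \forall y \near x, `|f y - f x| <= c * `|y - x|.
Proof.
move=> df; have [k k0 dk] := linear_lipschitz (diff_continuous df).
exists (k + 1); first by rewrite addr_gt0.
apply: filterS (differentiable_le df ltr01) => y.
rewrite mul1r => H; rewrite -(subrK ('d f x (y - x)) (f y - f x)).
by rewrite (le_trans (ler_normD _ _))// mulrDl mul1r addrC lerD.
Qed.

Lemma ler_norm_entry m n (v : 'M[R]_(m, n)) i j : `|v i j| <= `|v|.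
Proof.
rewrite [leRHS]/Num.norm /= mx_normrE.
exact: (le_bigmax _ (fun ij => `|v ij.1 ij.2|) (i, j)).
Qed.

Lemma norm_mx_le m n (v : 'M[R]_(m, n)) (c : R) :
  0 <= c -> (forall i j, `|v i j| <= c) -> `|v| <= c.
Proof.
move=> c0 H; rewrite [leLHS]/Num.norm /= mx_normrE.
by apply/bigmax_leP; split=> // -[i j] _ /=.
Qed.

Lemma diff_rV_sum n (W : normedModType R) (f : 'rV[R]_n -> W) (p w : 'rV[R]_n) :
  differentiable f p ->
  'd f p w = \sum_(i < n) w 0 i *: 'D_(delta_mx 0 i) f p.
Proof.
move=> df; rewrite {1}(row_sum_delta w) linear_sum; apply: eq_bigr => i _.
by rewrite linearZ /= deriveE.
Qed.

Lemma cvg_finite_sum (V : normedModType R) (I : Type) (r : seq I) (T : Type)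
    (F : set_system T) (f : I -> T -> V) (l : I -> V) : Filter F ->
  (forall i, f i x @[x --> F] --> l i) ->
  \sum_(i <- r) f i x @[x --> F] --> \sum_(i <- r) l i.
Proof.
move=> FF H; elim: r => [|i r IH].
  by rewrite big_nil; under eq_fun do rewrite big_nil; exact: cvg_cst.
by rewrite big_cons; under eq_fun do rewrite big_cons; exact: cvgD.
Qed.

Lemma continuous_near_eq (T T' : topologicalType) (f g : T -> T') (t : T) :
  (\near t, f t = g t) -> {for t, continuous f} -> {for t, continuous g}.
Proof.
move=> fg cf A; rewrite -(nbhs_singleton fg) => /cf.
by apply: filterS2 fg => s /= ->.
Qed.

(** [Ck] only makes each directional derivative continuous. In finite dimension the differential is
    a finite combination of those along the basis vectors, whence joint continuity in point and
    vector. *)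
Lemma Ck1_diff_continuous n (W : normedModType R) (U : set 'rV[R]_n)
    (f : 'rV[R]_n -> W) (T : topologicalType) (p w : T -> 'rV[R]_n) (t : T) :
  Ck 1 U f -> nbhs (p t) U -> {for t, continuous p} -> {for t, continuous w} ->
  {for t, continuous (fun s => 'd f (p s) (w s))}.
Proof.
move=> [df cf] Up cp cw.
pose g s := \sum_(i < n) w s 0 i *: 'D_(delta_mx 0 i) f (p s).
have cg : {for t, continuous g}.
  apply: cvg_finite_sum => i; apply: cvgZ.
    apply: (@continuous_comp _ _ _ w (fun M : 'rV[R]_n => M 0 i)) => //.
    exact: coord_continuous.
  apply: (@continuous_comp _ _ _ p ('D_(delta_mx 0 i) f)) => //.
  by apply: cf; exact: nbhs_singleton.
apply: continuous_near_eq cg.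
have : \forall s \near t, U (p s) by exact: (cp _ Up).
apply: filterS => s Us /=; rewrite /g.
by rewrite diff_rV_sum //; exact: df.
Qed.

Lemma Ck1_diff_bounded n (W : normedModType R) (U : set 'rV[R]_n)
    (f : 'rV[R]_n -> W) (q : 'rV[R]_n) :
  Ck 1 U f -> nbhs q U ->
  exists2 L : R, 0 < L &
    \forall p \near q, forall w, `|'d f p w| <= L * `|w|.
Proof.
move=> [df cf] Uq.
(* The leading 1 keeps the constant positive when n = 0; the inner 1 is the room left for p to move
   away from q. *)
exists (1 + \sum_(i < n) (`|'D_(delta_mx 0 i) f q| + 1)).
  by rewrite ltr_pwDl// sumr_ge0.
near=> p; move=> w; rewrite diff_rV_sum; last by apply: df; near: p.
rewrite (le_trans (ler_norm_sum _ _ _))//.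
rewrite mulrDl mul1r -[leLHS]add0r lerD// mulr_suml ler_sum// => i _.
rewrite normrZ mulrC ler_pM//; last exact: ler_norm_entry.
move: i; near: p; apply: filter_forall => i.
have : `|'D_(delta_mx 0 i) f p| @[p --> q] --> `|'D_(delta_mx 0 i) f q|.
  apply: (@continuous_comp _ _ _ ('D_(delta_mx 0 i) f) Num.norm).
    exact: (cf (delta_mx 0 i) q (nbhs_singleton Uq)).
  exact: norm_continuous.
by move=> /cvgr_le; apply; rewrite ltrDl.
Unshelve. all: by end_near. Qed.

Lemma mean_value_le (V : normedModType R) (f : V -> R) (A : set V) (L : R) (p q : V) :
  (forall t : R, 0 <= t <= 1 -> A (p + t *: (q - p))) ->
  (forall x, A x -> differentiable f x /\ forall w, `|'d f x w| <= L * `|w|) ->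
  `|f q - f p| <= L * `|q - p|.
Proof.
move=> Aseg Af; pose h (t : R) := f (p + t *: (q - p)).
pose dh (t : R) := 'd f (p + t *: (q - p)) (q - p).
have dl (t : R) : is_diff t (fun s : R => p + s *: (q - p)) (fun s => s *: (q - p)).
  have d1 := is_diff_scalel t (q - p).
  have := @is_diffD R _ _ (cst p) _ 0 _ t (is_diff_cst p t) d1.
  by rewrite add0r.
have ish (t : R) : 0 <= t <= 1 -> is_derive t 1 h (dh t).
  move=> t01; have [d1 d2] := Af _ (Aseg _ t01).
  have D : differentiable h t.
    by apply: (@differentiable_comp _ _ _ _ (fun s : R => p + s *: (q - p)) f).
  apply: DeriveDef; first exact: diff_derivable.
  rewrite deriveE//.
  rewrite (@diff_comp _ _ _ _ (fun s : R => p + s *: (q - p)) f)//=.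
  by rewrite (diff_val (is_diff_def := dl t)) scale1r.
have [||c c01 /= E] := @MVT R h dh 0 1 ltr01.
- by move=> t /[!in_itv]/= /andP[? ?]; apply: ish; rewrite !ltW.
- apply: derivable_within_continuous => t /[!in_itv]/= t01.
  by have [] := ish t t01.
have -> : f q = h 1 by rewrite /h scale1r addrC subrK.
have -> : f p = h 0 by rewrite /h scale0r addr0.
rewrite E subr0 mulr1; apply: (Af _ _).2; apply: Aseg.
by move: c01; rewrite in_itv /= => /andP[? ?]; rewrite !ltW.
Qed.

End Calculus.

(** * Chain rule through charts and changes of charts *)

Section Charts.
Variables (R : realType) (n : nat) (M : ptopologicalType).

Section OneChart.
Variable c : chart R n M.

Lemma cdom_nbhs x : cdom c x -> nbhs x (cdom c).
Proof. by move=> cx; apply: open_nbhs_nbhs; split => //; exact: cdom_open. Qed.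

Lemma cimage_nbhs x : cdom c x -> nbhs (cmap c x) (cmap c @` cdom c).
Proof.
by move=> cx; apply: open_nbhs_nbhs; split; [exact: cimage_open | exists x].
Qed.

Lemma near_cinv x (O : set M) : cdom c x -> nbhs x O ->
  \forall q \near cmap c x,
    [/\ cdom c (cinv c q), cmap c (cinv c q) = q & O (cinv c q)].
Proof.
move=> cx Ox.
have cc : {for cmap c x, continuous (cinv c)}.
  by apply: cinv_continuous; exists x.
have H1 : \forall q \near cmap c x, O (cinv c q).
  by apply: (cc O); rewrite cmapK.
by apply: filterS2 H1 (cimage_nbhs cx) => q /[swap] -[z cz <-]; rewrite cmapK.
Qed.

Lemma cimage_nbhsI x (O : set M) : cdom c x -> nbhs x O ->
  nbhs (cmap c x) (cmap c @` (O `&` cdom c)).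
Proof.
move=> cx Ox; apply: filterS (near_cinv cx Ox) => q [cq E Oq].
by exists (cinv c q).
Qed.

(** [G \o e] factors through the chart only while [e] stays in its domain; continuity of [e] ensures
    this near [t], which is enough for derivatives. *)
Lemma differentiable_through_chart (V W : normedModType R) (e : V -> M)
    (G : M -> W) (t : V) x :
  e t = x -> cdom c x -> {for t, continuous e} ->
  differentiable (cmap c \o e) t ->
  differentiable (G \o cinv c) (cmap c x) ->
  differentiable (G \o e) t /\
  forall v, 'd (G \o e) t v
            = 'd (G \o cinv c) (cmap c x) ('d (cmap c \o e) t v).
Proof.
move=> <- ct ce de dG.
have := @differentiable_comp _ _ _ _ (cmap c \o e) (G \o cinv c) t de dG.
have E := @diff_comp _ _ _ _ (cmap c \o e) (G \o cinv c) t de dG.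
move=> /(differentiable_near_eq (g := G \o e)) [|dGe dGeE].
  have : \forall s \near t, cdom c (e s) by exact: (ce _ (cdom_nbhs ct)).
  by apply: filterS => s cs /=; rewrite cmapK.
split; first exact: dGe.
by move=> v; apply: etrans (dGeE v) _; rewrite E.
Qed.

End OneChart.

Variable A : smooth_atlas R n M.
Local Notation phi a := (cmap (charts (s := A) a)).
Local Notation psi a := (cinv (charts (s := A) a)).
Local Notation dom a := (cdom (charts (s := A) a)).

Lemma transition_C1 (a b : cidx A) x : dom a x -> dom b x ->
  Ck 1 (phi a @` (dom a `&` dom b)) (phi b \o psi a) /\
  nbhs (phi a x) (phi a @` (dom a `&` dom b)).
Proof.
move=> ax bx; split; first exact: charts_compatible.
by rewrite setIC; apply: cimage_nbhsI => //; exact: cdom_nbhs.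
Qed.

Lemma transition_differentiable (a b : cidx A) x : dom a x -> dom b x ->
  differentiable (phi b \o psi a) (phi a x).
Proof. by move=> ax bx; apply: (transition_C1 ax bx).1.1; exists x. Qed.

Lemma coord_changeE (a b : cidx A) x w :
  'd (phi b \o psi a) (phi a x) w
  = w *m coord_change (charts a) (charts b) x.
Proof. by rewrite /coord_change /jacobian mul_rV_lin1. Qed.

Lemma change_chart (W : normedModType R) (G : M -> W) (a b : cidx A) x :
  dom a x -> dom b x -> differentiable (G \o psi a) (phi a x) ->
  differentiable (G \o psi b) (phi b x) /\
  forall w, 'd (G \o psi b) (phi b x) w
    = 'd (G \o psi a) (phi a x) (w *m coord_change (charts b) (charts a) x).
Proof.
move=> ax bx dG.
have [||||//|d1 d2] := @differentiable_through_chart (charts a) _ _ (psi b) G (phi b x) x.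
- exact: cmapK.
- exact: ax.
- by apply: cinv_continuous; exists x.
- exact: transition_differentiable.
by split=> [|w]; [exact: d1|rewrite -coord_changeE; exact: d2].
Qed.

Lemma coord_changeK (a b : cidx A) x (w : 'rV[R]_n) : dom a x -> dom b x ->
  w *m coord_change (charts a) (charts b) x
    *m coord_change (charts b) (charts a) x = w.
Proof.
move=> ax bx.
have [_ E] := change_chart bx ax (transition_differentiable bx ax).
rewrite -[LHS]coord_changeE; rewrite -[LHS]E.
have [||_ ->] := @differentiable_near_eq R _ _ id (phi a \o psi a) (phi a x).
- by apply: filterS (cimage_nbhs ax) => q [z az <-] /=; rewrite cmapK.
- exact: ex_diff.
by rewrite diff_val.
Qed.

End Charts.

(** * The Riemannian norm in a fixed chart *)

Section ChartNorm.
Variables (R : realType) (n : nat) (M : ptopologicalType).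
Variables (A : smooth_atlas R n M) (g : riemannian_metric A).
Local Notation phi a := (cmap (charts (s := A) a)).
Local Notation psi a := (cinv (charts (s := A) a)).
Local Notation dom a := (cdom (charts (s := A) a)).

(** [metric_mx] may jump together with [chart_at]; the Gram matrix in the fixed chart [a] is what
    [metric_smooth] makes continuous. *)
Definition gram (a : cidx A) (q : 'rV[R]_n) : 'M[R]_n :=
  let x := psi a q in
  let J := coord_change (charts a) (chart_at A x) x in
  J *m metric_mx g x *m J^T.

Definition chart_norm (a : cidx A) (q w : 'rV[R]_n) : R :=
  Num.sqrt ((w *m gram a q *m w^T) 0 0).

Lemma tnorm_ge0 x v : 0 <= tnorm g x v.
Proof. exact: sqrtr_ge0. Qed.

Lemma tnorm_gt0 x v : v != 0 -> 0 < tnorm g x v.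
Proof. by move=> v0; rewrite sqrtr_gt0 metric_pos. Qed.

Lemma chart_normE a x w : dom a x -> chart_norm a (phi a x) w
  = tnorm g x (w *m coord_change (charts a) (chart_at A x) x).
Proof.
move=> ax; rewrite /chart_norm /gram cmapK // /tnorm trmx_mul.
by rewrite !mulmxA.
Qed.

Lemma tnormE a x v : dom a x -> tnorm g x v
  = chart_norm a (phi a x) (v *m coord_change (chart_at A x) (charts a) x).
Proof.
by move=> ax; rewrite chart_normE // coord_changeK//; exact: chart_idxP.
Qed.

Lemma chart_norm_ge0 a q w : 0 <= chart_norm a q w.
Proof. exact: sqrtr_ge0. Qed.

Lemma chart_normZ a q (t : R) w : chart_norm a q (t *: w) = `|t| * chart_norm a q w.
Proof.
rewrite /chart_norm -scalemxAl -scalemxAl linearZ /= -scalemxAr scalerA !mxE -expr2.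
by rewrite sqrtrM ?sqr_ge0// sqrtr_sqr.
Qed.

Lemma chart_norm_gt0 a x w : dom a x -> w != 0 -> 0 < chart_norm a (phi a x) w.
Proof.
move=> ax w0; rewrite chart_normE //; apply: tnorm_gt0; apply: contra w0 => /eqP w0.
by rewrite -(coord_changeK w ax (chart_idxP A x)) w0 mul0mx.
Qed.

Lemma chart_norm_continuous a (T : topologicalType) (p w : T -> 'rV[R]_n) t :
  {for t, continuous p} -> {for t, continuous w} -> (phi a @` dom a) (p t) ->
  {for t, continuous (fun s => chart_norm a (p s) (w s))}.
Proof.
move=> cp cw pt; apply: (@continuous_comp _ _ _
  (fun s => (w s *m gram a (p s) *m (w s)^T) 0 0) Num.sqrt); last exact: sqrt_continuous.
have E : (fun s => (w s *m gram a (p s) *m (w s)^T) 0 0)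
   = (fun s => \sum_j (\sum_i w s 0 i * gram a (p s) i j) * w s 0 j).
  apply/funext => s; rewrite mxE; apply: eq_bigr => j _; rewrite !mxE.
  by congr (_ * _).
rewrite E.
have cwi i : {for t, continuous (fun s => w s 0 i)}.
  apply: (@continuous_comp _ _ _ w (fun M : 'rV[R]_n => M 0 i)); first exact: cw.
  exact: coord_continuous.
have cgram : {for p t, continuous (gram a)} .
  have H : Ck 0 (phi a @` dom a) (gram a) := metric_smooth g a 0.
  exact: (H _ pt).
have cg i j : {for t, continuous (fun s => gram a (p s) i j)}.
  apply: (@continuous_comp _ _ _ (gram a \o p) (fun M : 'M[R]_n => M i j)).
    exact: continuous_comp cp cgram.
  exact: coord_continuous.
apply: (@cvg_finite_sum R R) => j; apply: cvgM; last exact: cwi.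
apply: (@cvg_finite_sum R R) => i; apply: cvgM; [exact: cwi|exact: cg].
Qed.

Lemma near_pinfty_gt (c : R) : \forall d \near (+oo : set_system R), c < d.
Proof. by apply: nbhs_pinfty_gt; rewrite num_real. Qed.

Lemma compact_sphere : compact [set w : 'rV[R]_n | `|w| = 1].
Proof.
apply: bounded_closed_compact.
  by exists 1; split=> // y y1 w /= ->; exact: ltW.
rewrite (_ : [set w | _] = (@Num.norm R 'rV[R]_n) @^-1` [set 1])//.
apply: preimage_closed; last exact: closed_eq.
by move=> w _; exact: norm_continuous.
Qed.

Lemma homogeneous_le (N : 'rV[R]_n -> R) (c : R) :
  (forall (t : R) w, N (t *: w) = `|t| * N w) ->
  (forall w, `|w| = 1 -> N w <= c) -> forall w, N w <= c * `|w|.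
Proof.
move=> NZ Nc w; have [->|w0] := eqVneq w 0.
  by rewrite normr0 mulr0 -(scale0r 0) NZ normr0 mul0r.
have nw : 0 < `|w| by rewrite normr_gt0.
rewrite -ler_pdivrMr// mulrC -[ `|w|^-1]ger0_norm ?invr_ge0// -NZ; apply: Nc.
by rewrite normrZ normfV normr_id mulVf// gt_eqF.
Qed.

(** Both inequalities are homogeneous in [w], hence reduce to the unit sphere. There the chart norm
    is positive and continuous, and compactness yields one constant for all [w] and all nearby
    [q]. *)
Lemma chart_norm_bounds_near a x : dom a x ->
  exists2 c : R, 0 < c & \forall q \near phi a x, forall w,
    chart_norm a q w <= c * `|w| /\ `|w| <= c * chart_norm a q w.
Proof.
move=> ax.
have := compact_sphere; rewrite compact_near_coveringP.
(* The parameter of the covering argument is a pair: a constant tending to infinity and a base point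
   tending to [phi a x]. *)
pose P (cq : R * 'rV[R]_n) w := chart_norm a cq.2 w <= cq.1 /\
   1 <= cq.1 * chart_norm a cq.2 w.
move=> /(_ _ (filter_prod +oo (nbhs (phi a x))) P) [].
  move=> w /= w1.
  have w0 : w != 0 by rewrite -normr_eq0 w1 oner_eq0.
  have N0 := chart_norm_gt0 ax w0.
  set N1 := chart_norm a (phi a x) w in N0.
  have cN : {for (w, phi a x), continuous (fun wq : 'rV[R]_n * 'rV[R]_n => chart_norm a wq.2 wq.1)}.
    by apply: chart_norm_continuous; [exact: cvg_snd|exact: cvg_fst|exists x].
  have [[U V] /= [Uw Vq] UV] : \forall wq \near (w, phi a x),
      N1 / 2 < chart_norm a wq.2 wq.1 /\ chart_norm a wq.2 wq.1 < N1 + 1.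
    near=> wq; split; near: wq.
      by apply: (cvgr_gt _ cN); rewrite /= -/N1 ltr_pdivrMr// ltr_pMr// ltr1n.
    by apply: (cvgr_lt _ cN); rewrite /= -/N1 ltrDl.
  exists (U, [set cq | (N1 + 1 < cq.1 /\ 2 / N1 < cq.1) /\ V cq.2]); first split => //=.
    exists ([set c | N1 + 1 < c /\ 2 / N1 < c], V) => //=.
    split=> //; near=> c; split; near: c; exact: near_pinfty_gt.
  move=> [w' [c q]] /= [Uw' [[c1 c2] Vq']].
  have /= [h1 h2] := UV (w', q) (conj Uw' Vq').
  split => /=; first exact/ltW/(lt_trans h2).
  have : 2 / N1 * (N1 / 2) <= c * chart_norm a q w'.
    by rewrite ler_pM// ?divr_ge0// ltW.
  by rewrite (_ : 2 / N1 * (N1 / 2) = 1)//; field; rewrite gt_eqF.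
move=> [B C] /= [Bc Cq] BC.
have [c [c0 Bc']] : exists c, 0 < c /\ B c.
  near (+oo : set_system R) => c; exists c; split; near: c; last exact: Bc.
  exact: near_pinfty_gt.
exists c => //; apply: filterS Cq => q Cq.
have H := BC (c, q) (conj Bc' Cq).
have H1 w : chart_norm a q w <= c * `|w|.
  apply: homogeneous_le; first by move=> t v; exact: chart_normZ.
  by move=> v v1; have [] := H v v1.
move=> w; split; first exact: H1.
(* The difference of the two sides is homogeneous as well, so the reduction to the sphere also
   serves the reverse inequality, with bound 0. *)
rewrite -subr_le0; have := @homogeneous_le (fun w => `|w| - c * chart_norm a q w) 0.
rewrite /= => /(_ _ _ w); rewrite mul0r; apply.
  by move=> t v; rewrite normrZ chart_normZ mulrBr; congr (_ - _); rewrite mulrCA.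
by move=> v v1; have [_] := H v v1; rewrite v1 subr_le0.
Unshelve. all: by end_near. Qed.

Lemma chart_norm_bounds a (Q : set 'rV[R]_n) :
  compact Q -> Q `<=` phi a @` dom a ->
  exists2 c : R, 0 < c & forall q, Q q -> forall w,
    chart_norm a q w <= c * `|w| /\ `|w| <= c * chart_norm a q w.
Proof.
move=> + Qdom; rewrite compact_near_coveringP.
pose P (c : R) q := forall w,
    chart_norm a q w <= c * `|w| /\ `|w| <= c * chart_norm a q w.
move=> /(_ _ (+oo : set_system R) P _) H.
have : \forall c \near (+oo : set_system R), Q `<=` P c.
  apply: H => q Qq; have [x ax <-] := Qdom q Qq.
  have [c c0 cx] := chart_norm_bounds_near ax.
  exists ([set q' | forall w, chart_norm a q' w <= c * `|w| /\
      `|w| <= c * chart_norm a q' w], [set d | c < d]).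
    by split => //=; exact: near_pinfty_gt.
  move=> [q' d] /= [H cd] w; have [h1 h2] := H w.
  split; [apply: (le_trans h1)|apply: (le_trans h2)].
    by rewrite ler_wpM2r// ltW.
  by rewrite ler_wpM2r ?chart_norm_ge0// ltW.
move=> {}H; near (+oo : set_system R) => c; exists c; last by near: c.
by near: c; exact: near_pinfty_gt.
Unshelve. all: by end_near. Qed.
End ChartNorm.

(** * Separating families of functions *)

Section Bump.
Variable R : realType.

(** The simplest differentiable function that vanishes exactly on the negative half-line; first
    derivatives are all that the bumps have to provide. *)
Definition pos_sqr (t : R) : R := Num.max 0 t ^+ 2.

Lemma pos_sqr_is_derive (t : R) : is_derive t 1 pos_sqr (2 * Num.max 0 t).
Proof.
have H : h^-1 *: (pos_sqr (h *: 1 + t) - pos_sqr t) @[h --> 0^'] --> 2 * Num.max 0 t.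
  apply/cvgrPdist_le => e e0; near=> h.
  have h0 : h != 0 by near: h; exact: nbhs_dnbhs_neq.
  have he : `|h| <= e by near: h; exact: dnbhs0_le.
  (* The difference quotient is within [|h|] of the limit: after multiplication by [|h|] this is an
     error of at most [h ^+ 2], checked in four sign cases. *)
  apply: le_trans he; rewrite /GRing.scale /= mulr1.
  rewrite -[leLHS](mulfK (x := `|h|)) ?normr_eq0// -normrM ler_pdivrMr ?normr_gt0//.
  rewrite mulrBl [h^-1 * _ * h]mulrAC mulVf// mul1r -expr2 real_normK ?num_real// ler_norml.
  rewrite /pos_sqr; case: (leP 0 t) => ht; case: (leP 0 (h + t)) => hht;
  rewrite ?(max_r ht) ?(max_r hht) ?(max_l (ltW ht)) ?(max_l (ltW hht));
  apply/andP; split; nra.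
apply: DeriveDef; first by apply/cvg_ex; eexists; exact: H.
exact/cvg_lim.
Unshelve. all: by end_near. Qed.

Lemma pos_sqr_is_diff (t : R) : is_diff t pos_sqr (fun h => h * (2 * Num.max 0 t)).
Proof.
have [d1 d2] := pos_sqr_is_derive t.
have D : differentiable pos_sqr t by apply/derivable1_diffP.
apply: DiffDef => //; rewrite diff1E//; apply/funext => h.
by rewrite derive1E d2.
Qed.

Variable n : nat.
Implicit Types q w : 'rV[R]_n.

Lemma is_diff_coord q (i : 'I_n) : is_diff q (fun q => q 0 i) (fun w => w 0 i).
Proof.
have lin : linear (fun q => q 0 i : R) by move=> a u v; rewrite !mxE.
pose fM := GRing.isLinear.Build _ _ _ _ _ lin.
pose f : {linear _ -> _} := HB.pack (fun q => q 0 i : R) fM.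
have -> : (fun q => q 0 i : R) = f by [].
have cf : continuous f by exact: coord_continuous.
apply: DiffDef; first exact: linear_differentiable.
by rewrite diff_lin.
Qed.

Lemma is_diff_sum (V : normedModType R) (I : Type) (s : seq I)
    (f df : I -> V -> R) (x : V) :
  (forall i, is_diff x (f i) (df i)) ->
  is_diff x (fun y => \sum_(i <- s) f i y) (fun y => \sum_(i <- s) df i y).
Proof.
move=> H; rewrite -!fct_sumE.
elim/big_ind2: _ => [|f1 d1 f2 d2 h1 h2|i _]; last exact: H.
  exact: is_diff_cst.
exact: is_diffD.
Qed.

Variables (q0 : 'rV[R]_n) (r : R).

(** The norm of ['rV[R]_n] is the sup norm, which is not differentiable; the Euclidean square takes
    its place in the bumps. *)
Definition sqdist q : R := \sum_(i < n) (q 0 i - q0 0 i) ^+ 2.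

Lemma sqdist_is_diff q :
  is_diff q sqdist (fun w => \sum_(i < n) 2 * (q 0 i - q0 0 i) * w 0 i).
Proof.
apply: is_diff_sum => i.
have H := is_diffX 1 (is_diffB (is_diff_coord q i) (is_diff_cst (q0 0 i) q)).
apply: (is_diff_eq H).
by apply/funext => w /=; rewrite !fctE /= subr0 expr1 /GRing.scale.
Qed.

Definition bump q : R := pos_sqr (r ^+ 2 - sqdist q).

Lemma bump_is_diff q : is_diff q bump (fun w =>
  - (\sum_(i < n) 2 * (q 0 i - q0 0 i) * w 0 i)
  * (2 * Num.max 0 (r ^+ 2 - sqdist q))).
Proof.
have H1 := is_diffB (is_diff_cst (r ^+ 2) q) (sqdist_is_diff q).
have H2 := pos_sqr_is_diff ((cst (r ^+ 2) - sqdist) q).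
apply: (is_diff_eq (is_diff_comp H1 H2)).
by apply/funext => w /=; rewrite !fctE /= sub0r.
Qed.

(** Where the bump is positive, each coordinate is the quotient of its cut-off version by the bump,
    so these n + 1 functions together determine points and tangent vectors. *)
Definition bump_coord (o : option 'I_n) q : R :=
  if o is Some i then bump q * q 0 i else bump q.

Lemma bump_coord_is_diff (i : 'I_n) q : is_diff q (bump_coord (Some i))
  (fun w => bump q * w 0 i + q 0 i * 'd bump q w).
Proof.
have H := is_diffM (differentiableP (ex_diff (is_diff_def := bump_is_diff q))) (is_diff_coord q i).
exact: (is_diff_eq H).
Qed.

Lemma bump_coord_differentiable o q : differentiable (bump_coord o) q.
Proof.
case: o => [i|]; first exact: (ex_diff (is_diff_def := bump_coord_is_diff i q)).
exact: (ex_diff (is_diff_def := bump_is_diff q)).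
Qed.

Lemma diff_bumpE q w : 'd bump q w =
  - (\sum_(i < n) 2 * (q 0 i - q0 0 i) * w 0 i)
  * (2 * Num.max 0 (r ^+ 2 - sqdist q)).
Proof. by rewrite (diff_val (is_diff_def := bump_is_diff q)). Qed.

Lemma diff_bump_coordE i q w : 'd (bump_coord (Some i)) q w =
  bump q * w 0 i + q 0 i * 'd bump q w.
Proof. by rewrite (diff_val (is_diff_def := bump_coord_is_diff i q)). Qed.

Lemma bump_out q : r ^+ 2 <= sqdist q -> bump q = 0.
Proof. by move=> h; rewrite /bump /pos_sqr max_l ?subr_le0// expr0n. Qed.

Lemma diff_bump_out o q w : r ^+ 2 <= sqdist q -> 'd (bump_coord o) q w = 0.
Proof.
move=> h; have E : 'd bump q w = 0 by rewrite diff_bumpE max_l ?subr_le0// !mulr0.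
case: o => [i|]; last exact: E.
by rewrite diff_bump_coordE E bump_out// mul0r mulr0 addr0.
Qed.

Hypothesis r0 : 0 < r.

Lemma sqdist_entry q i : sqdist q <= r ^+ 2 -> `|q 0 i - q0 0 i| <= r.
Proof.
move=> h; rewrite -(ler_pXn2r (n := 2))// ?nnegrE// ?(ltW r0)//.
rewrite real_normK ?num_real//; apply: le_trans h.
by rewrite /sqdist (bigD1 i)//= lerDl sumr_ge0// => j _; exact: sqr_ge0.
Qed.

Lemma bump_ge0 q : 0 <= bump q.
Proof. exact: sqr_ge0. Qed.

Lemma sqdist_ge0 q : 0 <= sqdist q.
Proof. by apply: sumr_ge0 => i _; exact: sqr_ge0. Qed.

Lemma diff_bump_coord_bound : exists2 K : R, 0 < K &
  forall o q w, `|'d (bump_coord o) q w| <= K * `|w|.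
Proof.
pose K0 := (\sum_(i < n) 2 * r) * (2 * r ^+ 2).
have K00 : 0 <= K0.
  apply: mulr_ge0; first by apply: sumr_ge0 => i _; rewrite mulr_ge0// ltW.
  by rewrite mulr_ge0// sqr_ge0.
have H0 q w : sqdist q <= r ^+ 2 -> `|'d bump q w| <= K0 * `|w|.
  move=> h; rewrite diff_bumpE normrM normrN /K0 mulrAC.
  apply: ler_pM => //.
    rewrite mulr_suml; apply: (le_trans (ler_norm_sum _ _ _)); apply: ler_sum => i _.
    rewrite normrM; apply: ler_pM => //; last exact: ler_norm_entry.
    by rewrite normrM ger0_norm// ler_pM2l//; exact: sqdist_entry.
  rewrite normrM ger0_norm// ler_pM2l// max_r ?subr_ge0// ger0_norm ?subr_ge0//.
  by rewrite gerBl sqdist_ge0.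
have bu q : sqdist q <= r ^+ 2 -> bump q <= r ^+ 2 ^+ 2.
  move=> h; rewrite /bump /pos_sqr max_r ?subr_ge0//.
  rewrite ler_pXn2r// ?nnegrE ?subr_ge0 ?sqr_ge0//.
  by rewrite gerBl sqdist_ge0.
have p2 : 0 <= (`|q0| + r) * K0 by rewrite mulr_ge0 ?addr_ge0// ltW.
have r4 : 0 <= r ^+ 2 ^+ 2 by rewrite !exprn_ge0// ltW.
(* On the support [K0] bounds the differential of the bump, [r ^+ 2 ^+ 2] the bump itself and
   [|q0| + r] the coordinates; the product rule combines them. *)
exists (K0 + r ^+ 2 ^+ 2 + (`|q0| + r) * K0).
  by rewrite ltr_wpDr// ltr_wpDl// !exprn_gt0.
move=> o q w; have [h|h] := leP (r ^+ 2) (sqdist q).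
  rewrite diff_bump_out// normr0 mulr_ge0//.
  by rewrite addr_ge0 ?addr_ge0.
have {}h := ltW h.
case: o => [i|]; last first.
  by rewrite (le_trans (H0 _ _ h))// ler_wpM2r// -addrA lerDl addr_ge0.
rewrite diff_bump_coordE (le_trans (ler_normD _ _))// [leRHS]mulrDl lerD//.
  rewrite normrM; apply: ler_pM => //; last exact: ler_norm_entry.
  by rewrite ger0_norm ?bump_ge0// ler_wpDl ?bu.
rewrite normrM -mulrA ler_pM// ?H0//.
rewrite -(subrK (q0 0 i) (q 0 i)) (le_trans (ler_normD _ _))// addrC lerD//.
  exact: ler_norm_entry.
exact: sqdist_entry.
Qed.

Lemma diff_bump_coord_lower i q w : bump q * `|w 0 i| <=
  `|'d (bump_coord (Some i)) q w| + `|q 0 i| * `|'d (bump_coord None) q w|.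
Proof.
rewrite -[bump q]ger0_norm ?bump_ge0// -!normrM.
rewrite (_ : bump q * w 0 i = 'd (bump_coord (Some i)) q w - q 0 i * 'd (bump_coord None) q w).
  exact: ler_normB.
by rewrite diff_bump_coordE addrK.
Qed.

Lemma bump_coord_separation i q q' : bump q * `|q 0 i - q' 0 i| <=
  `|bump_coord (Some i) q - bump_coord (Some i) q'|
  + `|q' 0 i| * `|bump_coord None q - bump_coord None q'|.
Proof.
rewrite -[bump q]ger0_norm ?bump_ge0// -!normrM /=.
rewrite (_ : bump q * (_ - _) = bump q * q 0 i - bump q' * q' 0 i - q' 0 i * (bump q - bump q')).
  exact: ler_normB.
by ring.
Qed.

Lemma bump_half q : sqdist q <= r ^+ 2 / 2 -> (r ^+ 2 / 2) ^+ 2 <= bump q.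
Proof.
move=> h; have r2 : 0 < r ^+ 2 by rewrite exprn_gt0.
rewrite /bump /pos_sqr max_r; last by lra.
by rewrite ler_pXn2r// ?nnegrE; lra.
Qed.

End Bump.

(** * Cut-off chart coordinates on the manifold *)

Section Embedding.
Variables (R : realType) (n : nat) (M : ptopologicalType).
Variables (A : smooth_atlas R n M) (g : riemannian_metric A).
Local Notation phi a := (cmap (charts (s := A) a)).
Local Notation psi a := (cinv (charts (s := A) a)).
Local Notation dom a := (cdom (charts (s := A) a)).

Definition dfun (u : M -> R) (x : M) : 'rV[R]_n -> R :=
  'd (u \o cinv (chart_at A x)) (cmap (chart_at A x) x).

(* The coordinates of a bi-Lipschitz-type embedding of M into a Euclidean
   space: the l^1 distance of the images replaces the Riemannian distance. *)
Record separating_family := SeparatingFamily {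
  sf_idx : finType;
  sf_fun : sf_idx -> M -> R;
  sf_cst : R;
  sf_cst_gt0 : 0 < sf_cst;
  sf_differentiable : forall i x, differentiable
    (sf_fun i \o cinv (chart_at A x)) (cmap (chart_at A x) x);
  sf_diff_le : forall i x w, `|dfun (sf_fun i) x w| <= sf_cst * tnorm g x w;
  sf_diff_ge : forall x w,
    tnorm g x w <= sf_cst * \sum_i `|dfun (sf_fun i) x w|;
  sf_chart : forall x0 : M, exists (b : cidx A) (O : set M) (L : R),
    [/\ nbhs x0 O, O `<=` dom b, 0 < L & forall z z', O z -> O z' ->
      `|phi b z - phi b z'| <= L * \sum_i `|sf_fun i z - sf_fun i z'| ];
  sf_injective : forall x y, (forall i, sf_fun i x = sf_fun i y) -> x = y
}.

Lemma closed_sqdist (q0 : 'rV[R]_n) (r : R) : 0 < r ->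
  compact [set q | sqdist q0 q <= r ^+ 2].
Proof.
move=> r0; apply: bounded_closed_compact.
  exists (`|q0| + r); split; first exact: num_real.
  move=> y yr q /= h; apply: le_trans (ltW yr).
  rewrite -(subrK q0 q) (le_trans (ler_normD _ _))// addrC lerD//.
  by apply: norm_mx_le => [|i j]; [exact: ltW|rewrite ord1 !mxE sqdist_entry].
rewrite (_ : [set q | _] = sqdist q0 @^-1` [set x | x <= r ^+ 2])//.
apply: preimage_closed; last exact: closed_le.
move=> q _; apply: differentiable_continuous.
exact: (ex_diff (is_diff_def := sqdist_is_diff q0 q)).
Qed.

Lemma chart_radius a x : dom a x -> exists2 r : R, 0 < r &
  [set q | sqdist (phi a x) q <= r ^+ 2] `<=` phi a @` dom a.
Proof.
move=> ax; have /nbhs_ballP[e /= e0 H] := cimage_nbhs ax.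
exists (e / 2); first by rewrite divr_gt0.
move=> q /= h; apply: H; rewrite -ball_normE /= distrC.
apply: (@le_lt_trans _ _ (e / 2)); last by rewrite ltr_pdivrMr// ltr_pMr// ltr1n.
apply: norm_mx_le => [|i j]; first by rewrite divr_ge0// ltW.
by rewrite ord1 !mxE sqdist_entry// divr_gt0.
Qed.

Section OneBump.
Variables (a : cidx A) (q0 : 'rV[R]_n) (r : R).
Hypothesis r0 : 0 < r.
Hypothesis Qdom : [set q | sqdist q0 q <= r ^+ 2] `<=` phi a @` dom a.

Definition chart_bump (o : option 'I_n) (x : M) : R :=
  if `[< dom a x >] then bump_coord q0 r o (phi a x) else 0.

Lemma chart_bumpE o x : dom a x -> chart_bump o x = bump_coord q0 r o (phi a x).
Proof. by move=> ax; rewrite /chart_bump asboolT. Qed.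

Lemma chart_bump_cinv o x : dom a x ->
  \forall q \near phi a x, bump_coord q0 r o q = (chart_bump o \o psi a) q.
Proof.
move=> ax; apply: filterS (near_cinv ax filterT) => q [aq qE _] /=.
by rewrite chart_bumpE// qE.
Qed.

Lemma chart_bump_diff_dom o x : dom a x ->
  differentiable (chart_bump o \o cinv (chart_at A x)) (cmap (chart_at A x) x) /\
  forall w, dfun (chart_bump o) x w =
    'd (bump_coord q0 r o) (phi a x) (w *m coord_change (chart_at A x) (charts a) x).
Proof.
move=> ax.
have [d1 d2] := differentiable_near_eq (chart_bump_cinv o ax)
  (bump_coord_differentiable q0 r o (phi a x)).
have [d3 d4] := change_chart ax (chart_idxP A x) d1.
split; first exact: d3.
by move=> w; apply: etrans (d4 w) _; exact: d2.
Qed.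

Hypothesis hausM : hausdorff_space M.

(** The support lies in the image under [psi a] of a compact set, which is compact and hence closed
    because M is Hausdorff. A point outside the chart domain thus has a neighbourhood on which the
    extension by 0 vanishes. *)
Lemma chart_bump_diff_out o x : ~ dom a x ->
  differentiable (chart_bump o \o cinv (chart_at A x)) (cmap (chart_at A x) x) /\
  forall w, dfun (chart_bump o) x w = 0.
Proof.
move=> nax.
pose K := psi a @` [set q | sqdist q0 q <= r ^+ 2].
have clK : closed K.
  apply: compact_closed => //; apply: continuous_compact; last exact: closed_sqdist.
  apply: continuous_in_subspaceT => q; rewrite inE => /Qdom qa.
  exact: cinv_continuous.
have nKx : ~ K x.
  by move=> [q /Qdom [z az <-]]; rewrite cmapK// => E; apply: nax; rewrite -E.
have H : \forall y \near x, chart_bump o y = 0.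
  have : nbhs x (~` K) by apply: open_nbhs_nbhs; split => //; exact: closed_openC.
  apply: filterS => y nKy; rewrite /chart_bump; case: asboolP => // ay.
  have b0 : bump q0 r (phi a y) = 0.
    apply: bump_out; rewrite leNgt; apply/negP => h; apply: nKy.
    by exists (phi a y); [exact: ltW|rewrite cmapK].
  by case: o => [i|]; rewrite /bump_coord b0 ?mul0r.
have H1 : \forall q \near cmap (chart_at A x) x,
    cst 0 q = (chart_bump o \o cinv (chart_at A x)) q :> R.
  by apply: filterS (near_cinv (chart_idxP A x) H) => q [_ _ /= ->].
have [d1 d2] := differentiable_near_eq H1 (differentiable_cst _ _).
split; first exact: d1.
by move=> w; apply: etrans (d2 w) _; rewrite diff_cst.
Qed.

Lemma chart_bump_diff_le : exists2 C : R, 0 < C &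
  forall o x w, `|dfun (chart_bump o) x w| <= C * tnorm g x w.
Proof.
have [K K0 HK] := diff_bump_coord_bound q0 r0.
have [c c0 Hc] := chart_norm_bounds g (closed_sqdist r0) Qdom.
exists (K * c); first by rewrite mulr_gt0.
move=> o x w; have [ax|nax] := pselect (dom a x); last first.
  rewrite (chart_bump_diff_out o nax).2 normr0 mulr_ge0 ?tnorm_ge0//.
  by rewrite mulr_ge0// ltW.
rewrite (chart_bump_diff_dom o ax).2.
have [h|h] := leP (r ^+ 2) (sqdist q0 (phi a x)).
  by rewrite diff_bump_out// normr0 mulr_ge0 ?tnorm_ge0 ?mulr_ge0// ltW.
rewrite (le_trans (HK _ _ _))// -mulrA ler_pM2l// (tnormE _ _ ax).
exact: (Hc _ (ltW h) _).2.
Qed.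

(** The region where the bump is at least [(r ^+ 2 / 2) ^+ 2], so that one can divide by it with a
    uniform bound. *)
Definition half_bump : set M := [set x | dom a x /\ sqdist q0 (phi a x) <= r ^+ 2 / 2].

Lemma half_sqdist x : half_bump x -> sqdist q0 (phi a x) <= r ^+ 2.
Proof.
move=> [_ h]; apply: le_trans h _; rewrite ler_pdivrMr// ler_peMr ?ler1n//.
by rewrite exprn_ge0// ltW.
Qed.

Lemma half_bump_entry x i : half_bump x -> `|phi a x 0 i| <= `|q0| + r.
Proof.
move=> hx; rewrite -(subrK (q0 0 i) (phi a x 0 i)) (le_trans (ler_normD _ _))// addrC lerD//.
  exact: ler_norm_entry.
exact/sqdist_entry/half_sqdist.
Qed.

Lemma chart_bump_diff_ge : exists2 C : R, 0 < C & forall x w, half_bump x ->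
  tnorm g x w <= C * \sum_o `|dfun (chart_bump o) x w|.
Proof.
have [c c0 Hc] := chart_norm_bounds g (closed_sqdist r0) Qdom.
pose t := (r ^+ 2 / 2) ^+ 2.
have t0 : 0 < t by rewrite exprn_gt0// divr_gt0// exprn_gt0.
have qr0 : 0 <= `|q0| + r by rewrite addr_ge0// ltW.
exists (c * ((1 + (`|q0| + r)) / t)).
  by rewrite mulr_gt0// divr_gt0// ltr_pwDl.
move=> x w hx; have [ax hs] := hx.
rewrite (tnormE _ _ ax); set w' := w *m _.
rewrite (le_trans (Hc _ (half_sqdist hx) w').1)// -mulrA ler_pM2l//.
set S := \sum_o _.
have S0 : 0 <= S by rewrite sumr_ge0.
have Si o : `|'d (bump_coord q0 r o) (phi a x) w'| <= S.
  rewrite -(chart_bump_diff_dom o ax).2 /S (bigD1 o)//= lerDl sumr_ge0//.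
apply: norm_mx_le => [|j i]; first by rewrite mulr_ge0// divr_ge0 ?(ltW t0)// addr_ge0.
rewrite ord1 mulrAC ler_pdivlMr// mulrC.
apply: (@le_trans _ _ (bump q0 r (phi a x) * `|w' 0 i|)).
  by rewrite ler_wpM2r//; exact: bump_half.
rewrite (le_trans (diff_bump_coord_lower _ _ _ _ _))// mulrDl mul1r lerD//.
by rewrite ler_pM//; exact: half_bump_entry.
Qed.

Lemma chart_bump_separation : exists2 L : R, 0 < L & forall x y,
  half_bump x -> half_bump y ->
  `|phi a x - phi a y| <= L * \sum_o `|chart_bump o x - chart_bump o y|.
Proof.
pose t := (r ^+ 2 / 2) ^+ 2.
have t0 : 0 < t by rewrite exprn_gt0// divr_gt0// exprn_gt0.
have qr0 : 0 <= `|q0| + r by rewrite addr_ge0// ltW.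
exists ((1 + (`|q0| + r)) / t); first by rewrite divr_gt0// ltr_pwDl.
move=> x y hx hy; set S := \sum_o _.
have [ax _] := hx; have [ay _] := hy.
have S0 : 0 <= S by rewrite sumr_ge0.
have Si o : `|bump_coord q0 r o (phi a x) - bump_coord q0 r o (phi a y)| <= S.
  by rewrite -!chart_bumpE// /S (bigD1 o)//= lerDl sumr_ge0.
apply: norm_mx_le => [|j i]; first by rewrite mulr_ge0// divr_ge0 ?(ltW t0)// addr_ge0.
rewrite ord1 !mxE mulrAC ler_pdivlMr// mulrC.
apply: (@le_trans _ _ (bump q0 r (phi a x) * `|phi a x 0 i - phi a y 0 i|)).
  by rewrite ler_wpM2r//; apply: bump_half => //; have [] := hx.
rewrite (le_trans (bump_coord_separation _ _ _ _ _))// mulrDl mul1r lerD//.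
by rewrite ler_pM//; exact: half_bump_entry.
Qed.

(** Here [y] is arbitrary: equality of the bumps themselves forces it into the chart domain, and
    equality of the cut-off coordinates then identifies it. Hence a cover by half bumps separates
    all points of M, also distant ones. *)
Lemma chart_bump_injective x y : half_bump x ->
  (forall o, chart_bump o x = chart_bump o y) -> x = y.
Proof.
move=> [ax hx] H.
have b0 : 0 < bump q0 r (phi a x).
  by apply: lt_le_trans (bump_half r0 hx); rewrite exprn_gt0// divr_gt0// exprn_gt0.
have ay : dom a y.
  apply: contrapT => nay; have := H None.
  rewrite chart_bumpE// /chart_bump asboolF//= => E.
  by move: b0; rewrite E ltxx.
have E o : bump_coord q0 r o (phi a x) = bump_coord q0 r o (phi a y).
  by rewrite -!chart_bumpE.
rewrite -(cmapK ax) -(cmapK ay); congr (psi a _); apply/rowP => i.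
have := E (Some i); have /= := E None; rewrite /= => <- /mulfI; apply.
by rewrite gt_eqF.
Qed.

End OneBump.

End Embedding.

Section EmbeddingExists.
Variables (R : realType) (n : nat) (M : ptopologicalType).
Variables (A : smooth_atlas R n M) (g : riemannian_metric A).
Local Notation phi a := (cmap (charts (s := A) a)).
Local Notation psi a := (cinv (charts (s := A) a)).
Local Notation dom a := (cdom (charts (s := A) a)).
Hypothesis hausM : hausdorff_space M.
Hypothesis compM : compact [set: M].

Lemma half_bump_nbhs a x r : 0 < r -> dom a x ->
  nbhs x (half_bump a (phi a x) r).
Proof.
move=> r0 ax; have r2 : 0 < r ^+ 2 / 2 by rewrite divr_gt0// exprn_gt0.
have cs : {for x, continuous (sqdist (phi a x) \o phi a)}.
  apply: continuous_comp; first exact: cmap_continuous.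
  exact/differentiable_continuous/(ex_diff (is_diff_def := sqdist_is_diff _ _)).
have s0 : sqdist (phi a x) (phi a x) = 0.
  by rewrite /sqdist big1// => i _; rewrite subrr expr0n.
have H : \forall y \near x, sqdist (phi a x) (phi a y) <= r ^+ 2 / 2.
  by apply: (cvgr_le _ cs); rewrite /= s0.
by apply: filterS2 (cdom_nbhs ax) H => y ay hy; split.
Qed.

Lemma ler_sum_pair (I J : finType) (F : I * J -> R) (i : I) :
  (forall ij, 0 <= F ij) -> \sum_j F (i, j) <= \sum_ij F ij.
Proof.
move=> F0; have -> : \sum_ij F ij = \sum_i \sum_j F (i, j).
  by rewrite pair_bigA; apply: eq_bigr => -[].
rewrite (bigD1 i)//= lerDl sumr_ge0// => k _; exact: sumr_ge0.
Qed.

Lemma separating_family_exists : exists e : separating_family g, True.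
Proof.
pose a x := chart_idx A x; pose q x := phi (a x) x.
have [r Hr] := choice (fun x => (exists2P _ _).1 (chart_radius (chart_idxP A x))).
have r0 x : 0 < r x by have [] := Hr x.
have rQ x : [set y | sqdist (q x) y <= r x ^+ 2] `<=` phi (a x) @` dom (a x).
  by have [] := Hr x.
pose u x := chart_bump (a x) (q x) (r x).
have [Cl HCl] := choice (fun x =>
  (exists2P _ _).1 (chart_bump_diff_le g (r0 x) (rQ x) hausM)).
have [Cg HCg] := choice (fun x => (exists2P _ _).1 (chart_bump_diff_ge g (r0 x) (rQ x))).
have [D' _ D'cov] : finite_subset_cover [set: M]
    (fun x => (half_bump (a x) (q x) (r x))°) [set: M].
  move: compM; rewrite compact_cover; apply => [x _|x _]; first exact: open_interior.
  by exists x => //; exact: (half_bump_nbhs (r0 x) (chart_idxP A x)).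
have cov x : exists z : D', (half_bump (a (val z)) (q (val z)) (r (val z)))° x.
  have [z /= zD' hz] := D'cov x I.
  by exists [` zD']%fset.
pose I : finType := (D' * option 'I_n)%type.
pose U (i : I) := u (val i.1) i.2.
pose C := 1 + \sum_(z : D') (`|Cl (val z)| + `|Cg (val z)|).
have C0 : 0 < C by rewrite ltr_pwDl// sumr_ge0// => z _; rewrite addr_ge0.
have zC (z : D') : `|Cl (val z)| + `|Cg (val z)| <= C.
  rewrite /C (bigD1 z)//= addrCA lerDl addr_ge0// sumr_ge0//.
have H1 i x : differentiable (U i \o cinv (chart_at A x)) (cmap (chart_at A x) x).
  case: i => [z o]; have [ax|nax] := pselect (dom (a (val z)) x).
    exact: (chart_bump_diff_dom (q (val z)) (r (val z)) o ax).1.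
  exact: (chart_bump_diff_out (r0 (val z)) (rQ (val z)) hausM o nax).1.
have H2 i x w : `|dfun A (U i) x w| <= C * tnorm g x w.
  case: i => [z o]; apply: le_trans ((HCl (val z)).2 o x w) _.
  rewrite ler_wpM2r ?tnorm_ge0//; apply: le_trans (zC z).
  by rewrite (le_trans (ler_norm _))// lerDl.
have H3 x w : tnorm g x w <= C * \sum_i `|dfun A (U i) x w|.
  have [z /interior_subset hz] := cov x.
  apply: le_trans ((HCg (val z)).2 x w hz) _.
  apply: ler_pM.
  - exact/ltW/(HCg (val z)).1.
  - exact: sumr_ge0.
  - by apply: le_trans (zC z); rewrite (le_trans (ler_norm _))// lerDr.
  - exact: (@ler_sum_pair _ _ (fun i : I => `|dfun A (U i) x w|) z).
have H4 (x : M) : exists (b : cidx A) (O : set M) (L : R),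
    [/\ nbhs x O, O `<=` dom b, 0 < L & forall y y', O y -> O y' ->
      `|phi b y - phi b y'| <= L * \sum_i `|U i y - U i y'| ].
  have [z hz] := cov x.
  have [L L0 HL] := chart_bump_separation (a (val z)) (q (val z)) (r0 (val z)).
  exists (a (val z)), (half_bump (a (val z)) (q (val z)) (r (val z))), L; split => //.
    by move=> y [].
  move=> y y' hy hy'; apply: le_trans (HL _ _ hy hy') _.
  rewrite ler_pM2l//.
  exact: (@ler_sum_pair _ _ (fun i : I => `|U i y - U i y'|) z).
have H5 x y : (forall i, U i x = U i y) -> x = y.
  move=> H; have [z /interior_subset hz] := cov x.
  apply: (chart_bump_injective (r0 (val z)) hz) => o.
  exact: (H (z, o)).
by exists (SeparatingFamily C0 H1 H2 H3 H4 H5).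
Qed.

End EmbeddingExists.

Lemma continuous_near (T T' : topologicalType) (f : T -> T') (t : T) (y : T')
    (P : T' -> Prop) :
  f t = y -> {for t, continuous f} -> (\forall z \near y, P z) ->
  \forall s \near t, P (f s).
Proof. by move=> <- cf; exact: cf. Qed.

Lemma eq_leW (R : realType) (x y : R) : x = y -> x <= y.
Proof. by move->. Qed.

Lemma ball_segment (R : realType) (V : normedModType R) (c p q : V) (r : R) :
  ball c r p -> ball c r q ->
  forall t, 0 <= t <= 1 -> ball c r (q + t *: (p - q)).
Proof.
rewrite -!ball_normE /= => cp cq t /andP[t0 t1].
rewrite (_ : c - _ = t *: (c - p) + (1 - t) *: (c - q)); last first.
  rewrite scalerBl scale1r addrCA -scalerBr opprD addrA -scalerN.
  congr (_ + _); congr (_ *: _); rewrite !opprB [RHS]addrC subrKA.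
  by [].
rewrite (le_lt_trans (ler_normD _ _))// !normrZ ger0_norm// ger0_norm ?subr_ge0//.
have [->|tn0] := eqVneq t 0; first by rewrite mul0r add0r subr0 mul1r.
rewrite (_ : r = t * r + (1 - t) * r); last by ring.
have tp : 0 < t by rewrite lt_neqAle eq_sym tn0.
rewrite ltr_leD// ?ltr_pM2l//.
by rewrite ler_wpM2l ?subr_ge0// ltW.
Qed.

(** * The distance [sdist] and the local inverses of f *)

Section SeparatingDistance.
Variables (R : realType) (n : nat) (M : ptopologicalType).
Variables (A : smooth_atlas R n M) (g : riemannian_metric A).
Variable e : separating_family g.
Local Notation phi a := (cmap (charts (s := A) a)).
Local Notation psi a := (cinv (charts (s := A) a)).
Local Notation dom a := (cdom (charts (s := A) a)).
Local Notation u := (@sf_fun _ _ _ _ _ e).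
Hypothesis compM : compact [set: M].

Definition sdist (x y : M) : R := \sum_i `|u i x - u i y|.

Lemma sdist_ge0 x y : 0 <= sdist x y.
Proof. exact: sumr_ge0. Qed.

Lemma sdistC x y : sdist x y = sdist y x.
Proof. by apply: eq_bigr => i _; rewrite distrC. Qed.

Lemma sdistxx x : sdist x x = 0.
Proof. by rewrite /sdist big1// => i _; rewrite subrr normr0. Qed.

Lemma sdist_triangle y x z : sdist x z <= sdist x y + sdist y z.
Proof.
rewrite /sdist -big_split; apply: ler_sum => i _ /=.
exact: ler_distD.
Qed.

Lemma sdist_gt0 x y : x <> y -> 0 < sdist x y.
Proof.
move=> xy; rewrite lt_neqAle sdist_ge0 andbT eq_sym; apply/eqP => s0; apply: xy.
apply: (@sf_injective _ _ _ _ _ e) => i; apply/eqP; rewrite -subr_eq0 -normr_le0 -s0.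
by rewrite /sdist (bigD1 i)//= lerDl sumr_ge0.
Qed.

Lemma sf_differentiable_chart i a x : dom a x ->
  differentiable (u i \o psi a) (phi a x) /\
  forall w, `|'d (u i \o psi a) (phi a x) w|
    <= sf_cst e * chart_norm g a (phi a x) w.
Proof.
move=> ax.
have [d1 d2] := change_chart (chart_idxP A x) ax (@sf_differentiable _ _ _ _ _ e i x).
split; first exact: d1.
move=> w; rewrite (chart_normE g _ ax); apply: le_trans (@sf_diff_le _ _ _ _ _ e i x _).
by apply: eq_leW; congr (`|_|); exact: d2.
Qed.

Lemma sf_continuous i : continuous (u i).
Proof.
move=> x; have ax := chart_idxP A x.
apply: (@continuous_near_eq _ _ ((u i \o psi (chart_idx A x)) \o phi (chart_idx A x))).
  by apply: filterS (cdom_nbhs ax) => y ay /=; rewrite cmapK.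
apply: continuous_comp; first exact: cmap_continuous.
exact/differentiable_continuous/(@sf_differentiable _ _ _ _ _ e).
Qed.

Lemma sdist_continuous (T : topologicalType) (p q : T -> M) t :
  {for t, continuous p} -> {for t, continuous q} ->
  {for t, continuous (fun s => sdist (p s) (q s))}.
Proof.
move=> cp cq; apply: (@cvg_finite_sum R R) => i.
apply: (@continuous_comp _ _ _ (fun s => u i (p s) - u i (q s)) Num.norm).
  apply: cvgB.
    by apply: (@continuous_comp _ _ _ p (u i)) => //; exact: sf_continuous.
  by apply: (@continuous_comp _ _ _ q (u i)) => //; exact: sf_continuous.
exact: norm_continuous.
Qed.

Lemma sdist_ball_nbhs x (d : R) : 0 < d -> \forall y \near x, sdist x y < d.
Proof.
move=> d0.
have H : {for x, continuous (fun y => sdist x y)}.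
  by apply: sdist_continuous; [exact: cvg_cst|exact: cvg_id].
by apply: (cvgr_lt _ H); rewrite sdistxx.
Qed.

(** [sdist x] is continuous and positive away from [x], so on the compact complement of the interior
    of [O] it attains a positive minimum, which serves as radius. *)
Lemma nbhs_sdist_ball x (O : set M) : nbhs x O ->
  exists2 d : R, 0 < d & forall y, sdist x y < d -> O y.
Proof.
move=> Ox; have [/set0P[z zO]|] := boolP (~` O° != set0); last first.
  move=> /negPn/eqP E; exists 1 => // y _; apply: interior_subset; apply: contrapT => h.
  by have : (~` O°) y := h; rewrite E.
have cO : compact (~` O°).
  apply: subclosed_compact compM _ => //; exact/open_closedC/open_interior.
have [||m mO mmin] := compact_EVT_min (f := sdist x) _ cO; first by exists z.
  apply: continuous_subspaceT => y.
  by apply: sdist_continuous; [exact: cvg_cst|exact: cvg_id].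
rewrite inE in mO.
exists (sdist x m); first by apply: sdist_gt0 => E; apply: mO; rewrite -E.
move=> y ym; apply: interior_subset; apply: contrapT => yO.
by have := mmin y; rewrite inE leNgt ym => /(_ yO).
Qed.

Variable f : M -> M.
Hypothesis fC1 : C1_local_diffeo A f.

Lemma f_continuous : continuous f.
Proof.
move=> x; have [U [h [[_ Ux _] [_ [cf _] _]]]] := fC1 x.
exact: cf.
Qed.

Lemma f_differentiable x : differentiable
  (cmap (chart_at A (f x)) \o f \o cinv (chart_at A x)) (cmap (chart_at A x) x).
Proof.
have [U [h [[_ Ux _] [_ [_ cf] _]]]] := fC1 x.
have [df _] := cf (chart_idx A x) (chart_idx A (f x)).
apply: df; exists x => //; split; last exact: chart_idxP.
by split => //; exact: chart_idxP.
Qed.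

(** With [h] the local inverse, [u i] equals [u i \o h] after [f]. The latter has a bounded
    differential in a chart around [f x0], so the mean value inequality on a ball bounds it by chart
    differences, and these are bounded by [sdist] through [sf_chart]. *)
Lemma inverse_lipschitz_near (x0 : M) : exists2 L : R, 0 < L & exists2 O : set M,
  nbhs x0 O & forall x y, O x -> O y -> sdist x y <= L * sdist (f x) (f y).
Proof.
have [U [h [[oU Ux ofU] [hK [cf _] [ch Ch]]]]] := fC1 x0.
have [b [B [Lb [Bz Bb Lb0 HLb]]]] := sf_chart e (f x0).
pose a := chart_idx A x0.
have ax : dom a x0 by exact: chart_idxP.
have bz : dom b (f x0) by apply: Bb; exact: nbhs_singleton.
pose V := f @` U `&` dom b `&` h @^-1` dom a.
have hz : h (f x0) = x0 by exact: hK.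
have nV : nbhs (f x0) V.
  apply: filterI; first apply: filterI.
  - by apply: open_nbhs_nbhs; split=> //; exists x0.
  - exact: cdom_nbhs.
  - have : {for f x0, continuous h} by apply: ch; exists x0.
    by apply; rewrite hz; exact: cdom_nbhs.
have nW : nbhs (phi b (f x0)) (phi b @` V).
  apply: filterS (cimage_nbhsI bz nV) => _ [z [Vz _] <-]; by exists z.
have CV : Ck 1 (phi b @` V) (phi a \o h \o psi b) by exact: Ch.
have [dH _] := CV.
have [Lh Lh0 HLh] := Ck1_diff_bounded CV nW.
have [c c0 Hc] := chart_norm_bounds_near g ax.
have H : \forall q \near phi b (f x0), forall i, differentiable (u i \o h \o psi b) q /\
    forall w, `|'d (u i \o h \o psi b) q w| <= sf_cst e * c * Lh * `|w|.
  have cH : {for phi b (f x0), continuous (phi a \o h \o psi b)}.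
    exact/differentiable_continuous/dH/(nbhs_singleton nW).
  have H0 : (phi a \o h \o psi b) (phi b (f x0)) = phi a x0.
    by rewrite /= cmapK// hz.
  have Hc' : \forall q \near phi b (f x0), forall w,
      chart_norm g a ((phi a \o h \o psi b) q) w <= c * `|w|.
    apply: (continuous_near (P := fun q => forall w, chart_norm g a q w <= c * `|w|) H0 cH).
    by apply: filterS Hc => q Hq w; have [] := Hq w.
  apply: filterS3 nW HLh Hc' => q Wq Lq cq i.
  have [z [[[y Uy yz] bz'] haz] zq] := Wq.
  have zq' : psi b q = z by rewrite -zq cmapK.
  have hq : (h \o psi b) q = h z by rewrite /= zq'.
  have cq' : {for q, continuous (h \o psi b)}.
    apply: continuous_comp; first by apply: cinv_continuous; exists z.
    by rewrite zq'; apply: ch; exists y.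
  have dq : differentiable (phi a \o (h \o psi b)) q by exact: dH.
  have [dui dui_le] := sf_differentiable_chart i haz.
  have [d1 d2] := differentiable_through_chart (c := charts a) hq haz cq' dq dui.
  split; first exact: d1.
  move=> w; apply: le_trans (_ : sf_cst e * (c * (Lh * `|w|)) <= _); last by rewrite !mulrA.
  have := dui_le ('d (phi a \o h \o psi b) q w); move=> dle.
  apply: le_trans (_ : `|'d (u i \o psi a) (phi a (h z)) ('d (phi a \o h \o psi b) q w)| <= _).
    by apply: eq_leW; congr (`|_|); exact: d2.
  apply: (le_trans dle); rewrite ler_pM2l ?sf_cst_gt0//.
  have := cq ('d (phi a \o h \o psi b) q w); rewrite /= zq' => cqw.
  by apply: (le_trans cqw); rewrite ler_pM2l//.
move: H => /nbhs_ballP[r /= r0 Hr].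
pose K := sf_cst e * c * Lh.
have K0 : 0 < K by rewrite !mulr_gt0 ?sf_cst_gt0.
(* The sum over the indices multiplies the bound by their number; the successor keeps the constant
   positive if there are none. *)
exists (#|sf_idx e|.+1%:R * (K * Lb)); first by rewrite mulr_gt0 ?ltr0n// mulr_gt0.
pose O' := U `&` f @^-1` (B `&` phi b @^-1` ball (phi b (f x0)) r).
exists O'.
  apply: filterI; first exact: open_nbhs_nbhs.
  have nB : nbhs (f x0) (B `&` phi b @^-1` ball (phi b (f x0)) r).
    apply: filterI; first exact: Bz.
    apply: (continuous_near (y := phi b (f x0))); first by [].
      exact: cmap_continuous.
    exact: nbhsx_ballx.
  exact: continuous_near (erefl (f x0)) (cf _ Ux) nB.
move=> x y [Ux' [Bfx bx]] [Uy' [Bfy by_]].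
have ui i : `|u i x - u i y| <= K * (Lb * sdist (f x) (f y)).
  have E t : U t -> B (f t) -> u i t = (u i \o h \o psi b) (phi b (f t)).
    by move=> Ut Bt /=; rewrite cmapK ?hK//; exact: Bb.
  rewrite (E x)// (E y)//.
  apply: le_trans (_ : K * `|phi b (f x) - phi b (f y)| <= _); last first.
    by rewrite ler_pM2l//; exact: HLb.
  apply: (mean_value_le (A := ball (phi b (f x0)) r)); first exact: ball_segment.
  by move=> q /Hr /(_ i).
rewrite -mulrA /sdist; apply: (@le_trans _ _ (\sum_(i : sf_idx e) K * (Lb * sdist (f x) (f y)))).
  by apply: ler_sum => i _; exact: ui.
rewrite sumr_const -mulrA -/(sdist _ _) -[leLHS]mulr_natl ler_wpM2r// ?ler_nat//.
by rewrite mulr_ge0 ?(ltW K0)// mulr_ge0 ?(ltW Lb0)// sdist_ge0.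
Qed.

(** One integer is both the Lipschitz constant and the reciprocal of the radius: increasing it
    weakens both requirements, which lets compactness turn the local constants into a global one. *)
Lemma inverse_lipschitz : exists2 k : nat, (0 < k)%N & forall x y,
  sdist x y < k%:R^-1 -> sdist x y <= k%:R * sdist (f x) (f y).
Proof.
have := compM; rewrite compact_near_coveringP.
pose P (k : nat) x := (0 < k)%N /\ forall y, sdist x y < k%:R^-1 ->
  sdist x y <= k%:R * sdist (f x) (f y).
move=> /(_ nat \oo P _) H.
have : \forall k \near \oo, [set: M] `<=` P k.
  apply: H => x0 _; have [L L_gt0 [B Bx0 HB]] := inverse_lipschitz_near x0.
  have [r r0 Hr] := nbhs_sdist_ball Bx0.
  exists ([set x | sdist x0 x < r / 2], [set k : nat | L + 2 / r < k%:R]).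
    split => /=; first by apply: sdist_ball_nbhs; rewrite divr_gt0.
    exact: nbhs_infty_gtr.
  move=> [x k] /= [x0x kL].
  have k0 : 0 < k%:R :> R by apply: lt_trans kL; rewrite addr_gt0 ?divr_gt0.
  split; first by rewrite -(ltr_nat R).
  move=> y xy.
  have kr : k%:R^-1 < r / 2.
    rewrite invf_plt ?posrE ?divr_gt0// invf_div; apply: lt_trans kL.
    by rewrite ltrDr.
  have Bx : B x by apply: Hr; apply: lt_trans x0x _; rewrite ltr_pdivrMr// ltr_pMr// ltr1n.
  have By : B y.
    apply: Hr; rewrite (le_lt_trans (sdist_triangle x _ _))// [ltRHS]splitr ltrD//.
    exact: lt_trans kr.
  apply: (le_trans (HB _ _ Bx By)); rewrite ler_wpM2r ?sdist_ge0// ltW//.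
  by apply: lt_trans kL; rewrite ltrDl divr_gt0.
move=> {}H; have [k Hk] := @filter_ex _ _ _ _ H.
exists k; first by have [] := Hk point I.
by move=> x y; have [_] := Hk x I; apply.
Qed.

End SeparatingDistance.

(** * Riemannian distance and measurability of [Gamma_plus] *)

Section IntegralBound.
Variable R : realType.
Local Notation mu := (@lebesgue_measure R).

(** No integral of [dU] is taken. Instead, for a primitive [H] of [h] and a sign [s], the function
    [H - s * U] has a nonnegative derivative, and the mean value theorem shows that it does not
    decrease. *)
Lemma continuous_integral_bound (U dU h : R -> R) (a b : R) : a < b ->
  (forall t : R, is_derive t 1 U (dU t)) -> (forall t, `|dU t| <= h t) ->
  continuous h ->
  (`|U b - U a|%:E <= \int[mu]_(t in `[a, b]) (h t)%:E)%E.
Proof.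
move=> ab dUP dUh ch.
(* Integrating from [a - 1] makes the primitive differentiable at the endpoint [a] too. *)
pose H x := (\int[mu]_(t in `[a - 1, x]) h t)%R.
have ih : mu.-integrable `[a - 1, b + 1] (EFin \o h).
  apply: continuous_compact_integrable; first exact: segment_compact.
  exact: continuous_subspaceT.
have dH (x : R) : a - 1 < x < b + 1 -> derivable H x 1 /\ derive1 H x = h x.
  by move=> /andP[ax xb]; apply: (continuous_FTC1_closed xb ih ax); exact: ch.
have dHab (x : R) : a <= x <= b -> is_derive x 1 H (h x).
  move=> /andP[ax xb]; have [|d1 d2] := dH x.
    by rewrite (lt_le_trans _ ax) ?gtrBl// (le_lt_trans xb)// ltrDl.
  apply: DeriveDef; first exact: d1.
  by rewrite -derive1E; exact: d2.
have cH (x : R) : a <= x <= b -> {for x, continuous H}.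
  move=> xab; apply/differentiable_continuous/derivable1_diffP.
  by have [] := dHab x xab.
have aab : a <= a <= b by rewrite lexx ltW.
have bab : a <= b <= b by rewrite lexx ltW.
rewrite (continuous_FTC2 (F := H) ab); first last.
- move=> x /[!in_itv]/= /andP[ax xb].
  by have [|_ ->] := dH x; rewrite ?(lt_trans _ ax) ?gtrBl// (lt_trans xb)// ltrDl.
- split; first by move=> x /[!in_itv]/= /andP[ax xb]; have [] := dHab x _; rewrite ?ltW.
    exact: cvg_at_right_filter (cH _ aab).
  exact: cvg_at_left_filter (cH _ bab).
- exact: continuous_subspaceT.
have mono (s : R) : `|s| = 1 -> s * (U b - U a) <= H b - H a.
  move=> s1; rewrite -subr_ge0.
  have [||c cab E] := @MVT R (fun x => H x - s * U x) (fun x => h x - s * dU x) a b ab.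
  - move=> x /[!in_itv]/= /andP[ax xb].
    have d1 : is_derive x 1 H (h x) by apply: dHab; rewrite !ltW.
    have d2 := is_deriveZ s (dUP x).
    exact: (is_deriveB d1 d2).
  - apply: derivable_within_continuous => x /[!in_itv]/= xab.
    have d1 : is_derive x 1 H (h x) by exact: dHab.
    have d2 := is_deriveZ s (dUP x).
    by have [] := is_deriveB d1 d2.
  have -> : H b - H a - s * (U b - U a) = (H b - s * U b) - (H a - s * U a) by ring.
  rewrite E mulr_ge0 ?subr_ge0 ?(ltW ab)//.
  apply: le_trans (dUh c); rewrite (le_trans (ler_norm _))//.
  by rewrite normrM s1 mul1r.
have := mono 1; have := mono (-1); rewrite normrN normr1 mulN1r mul1r.
move=> /(_ erefl) h1 /(_ erefl) h2.
by rewrite -EFinB lee_fin ler_norml h2 andbT lerNl.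
Qed.

End IntegralBound.

(** * Lengths of curves bound [sdist] *)

Section Curves.
Variables (R : realType) (n : nat) (M : ptopologicalType).
Variables (A : smooth_atlas R n M) (g : riemannian_metric A).
Variable e : separating_family g.
Local Notation phi a := (cmap (charts (s := A) a)).
Local Notation psi a := (cinv (charts (s := A) a)).
Local Notation dom a := (cdom (charts (s := A) a)).
Local Notation u := (@sf_fun _ _ _ _ _ e).
Local Notation mu := (@lebesgue_measure R).

Definition speed (c : R -> M) (t : R) : R := tnorm g (c t) (velocity A c t).

Lemma speed_ge0 c t : 0 <= speed c t.
Proof. exact: tnorm_ge0. Qed.

Lemma C1_curve_chart (c : R -> M) a t : C1_curve A c -> dom a (c t) ->
  differentiable (phi a \o c) t /\ {for t, continuous (derive1 (phi a \o c))}.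
Proof.
move=> [cc Cc] ac; have [d1 d2] := Cc a.
split; first exact: d1.
have := d2 1 t ac.
have -> : 'D_1 (phi a \o c) = derive1 (phi a \o c) by apply/funext => s; rewrite derive1E.
by [].
Qed.

Lemma derive1_diff (V : normedModType R) (F : R -> V) t : differentiable F t ->
  derive1 F t = 'd F t 1.
Proof. by move=> dF; rewrite derive1E deriveE. Qed.

Lemma speed_chart (c : R -> M) a t : {for t, continuous c} ->
  dom a (c t) -> differentiable (phi a \o c) t ->
  speed c t = chart_norm g a (phi a (c t)) (derive1 (phi a \o c) t).
Proof.
move=> cc ac dc; rewrite (chart_normE _ _ ac) -coord_changeE.
have [d1 d2] := differentiable_through_chart (G := cmap (chart_at A (c t)))
  erefl ac cc dc (transition_differentiable ac (chart_idxP A (c t))).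
rewrite /speed /velocity; congr (tnorm _ _ _).
rewrite (derive1_diff d1) (derive1_diff dc); exact: d2.
Qed.

(** The velocity is written in a chart that may change wildly with time, but its norm can be
    computed near [t] in the single chart chosen at [c t]. *)
Lemma speed_continuous c : C1_curve A c -> continuous (speed c).
Proof.
move=> Cc t; have [cc _] := Cc; pose a := chart_idx A (c t).
have ac : dom a (c t) by exact: chart_idxP.
apply: (@continuous_near_eq _ _ (fun s => chart_norm g a (phi a (c s)) (derive1 (phi a \o c) s))).
  have : \forall s \near t, dom a (c s).
    exact: continuous_near (erefl (c t)) (cc t) (cdom_nbhs ac).
  apply: filterS => s acs; rewrite (speed_chart _ acs)//; first exact: cc.
  exact: (C1_curve_chart Cc acs).1.
apply: chart_norm_continuous.
- apply: (@continuous_comp _ _ _ c (phi a)); [exact: cc|exact: cmap_continuous].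
- exact: (C1_curve_chart Cc ac).2.
- by exists (c t).
Qed.

Lemma sf_curve i c (t : R) : C1_curve A c ->
  is_derive t 1 (u i \o c) (derive1 (u i \o c) t) /\
  `|derive1 (u i \o c) t| <= sf_cst e * speed c t.
Proof.
move=> Cc; have [cc _] := Cc.
have ac := chart_idxP A (c t).
have [dc _] := C1_curve_chart Cc ac.
have [d1 d2] := differentiable_through_chart (G := u i) erefl ac (cc t) dc
  (@sf_differentiable _ _ _ _ _ e i (c t)).
split; first by rewrite derive1E; exact/derivableP/diff_derivable.
apply: le_trans (_ : `|dfun A (u i) (c t) (velocity A c t)| <= _); last exact: sf_diff_le.
apply: eq_leW; congr (`|_|); rewrite (derive1_diff d1) /velocity (derive1_diff dc).
exact: d2.
Qed.

Lemma sdist_C1_curve c a b : C1_curve A c -> a < b ->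
  ((sdist e (c a) (c b))%:E <= (#|sf_idx e|%:R * sf_cst e)%:E *
    \int[mu]_(t in `[a, b]) (speed c t)%:E)%E.
Proof.
move=> Cc ab.
have cs := speed_continuous Cc.
have H i : (`|u i (c b) - u i (c a)|%:E <=
    (sf_cst e)%:E * \int[mu]_(t in `[a, b]) (speed c t)%:E)%E.
  rewrite -ge0_integralZl_EFin//; first last.
  - exact/ltW/sf_cst_gt0.
  - apply/measurable_EFinP; apply: measurable_funTS; exact: continuous_measurable_fun.
  - by move=> t _; rewrite lee_fin speed_ge0.
  under eq_integral do rewrite -EFinM.
  apply: (continuous_integral_bound (U := u i \o c) (dU := derive1 (u i \o c))) => //.
  - by move=> t; have [] := sf_curve i t Cc.
  - by move=> t; have [] := sf_curve i t Cc.
  - move=> t; apply: cvgM; [exact: cvg_cst|exact: cs].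
apply: (@le_trans _ _ (\sum_(i : sf_idx e) ((sf_cst e)%:E * \int[mu]_(t in `[a, b]) (speed c t)%:E))%E).
  rewrite /sdist -sumEFin; apply: lee_sum => i _; rewrite distrC; exact: H.
by rewrite sumr_const EFinM -muleA mule_natl.
Qed.

End Curves.

Lemma ge0_integral_itv_split (R : realType) (h : R -> R) (a b d : R) :
  a <= b -> b <= d -> measurable_fun `[a, b] h -> measurable_fun `[b, d] h ->
  (forall t, 0 <= h t) -> measurable_fun `[a, d] h /\
  (\int[@lebesgue_measure R]_(t in `[a, d]) (h t)%:E
   = \int[@lebesgue_measure R]_(t in `[a, b]) (h t)%:E
     + \int[@lebesgue_measure R]_(t in `[b, d]) (h t)%:E)%E.
Proof.
move=> ab bd m1 m2 h0.
have EU : [set` `[a, d]] = [set` `[a, b]] `|` [set` `]b, d]].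
  by apply: (@itv_bndbnd_setU _ R (BLeft a) (BRight b) (BRight d)); rewrite bnd_simp.
have m2' : measurable_fun `]b, d] h by exact: measurable_fun_itv_oc m2.
have mU : measurable_fun ([set` `[a, b]] `|` [set` `]b, d]]) h.
  by apply/measurable_funU => //; split.
split; first by rewrite EU.
rewrite EU ge0_integral_setU//; first last.
- rewrite disj_set2E; apply/eqP/seteqP; split=> // t [] /=; rewrite !in_itv /=.
  by move=> /andP[_ tb] /andP[bt _]; rewrite leNgt bt in tb.
- by move=> t _; rewrite lee_fin.
- exact/measurable_EFinP.
by rewrite integral_itv_obnd_cbnd//; exact/measurable_EFinP.
Qed.

Section PiecewiseCurves.
Variables (R : realType) (n : nat) (M : ptopologicalType).
Variables (A : smooth_atlas R n M) (g : riemannian_metric A).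
Variable e : separating_family g.
Local Notation mu := (@lebesgue_measure R).

Lemma speed_near_eq (c c' : R -> M) t : (\forall s \near t, c s = c' s) ->
  speed g c t = speed g c' t.
Proof.
move=> cc'; have E : c t = c' t by exact: nbhs_singleton cc'.
rewrite /speed /velocity E; congr (tnorm _ _ _); rewrite !derive1E.
by apply: near_eq_derive; apply: filterS cc' => s /= ->.
Qed.

(** Only the open interval is allowed: at an endpoint the two-sided derivative of [c] also sees the
    neighbouring piece. *)
Lemma speed_piece (c c' : R -> M) (a b : R) t : a < t < b ->
  {in `[a, b], c =1 c'} -> speed g c t = speed g c' t.
Proof.
move=> tab cc'; apply: speed_near_eq.
have : \forall s \near t, s \in `]a, b[ by apply: near_in_itvoo; rewrite in_itv.
apply: filterS => s; rewrite in_itv /= => /andP[sa sb]; apply: cc'.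
by rewrite in_itv /= !ltW.
Qed.

Lemma speed_piece_integral (c c' : R -> M) (a b : R) :
  C1_curve A c' -> {in `[a, b], c =1 c'} ->
  measurable_fun `[a, b] (speed g c) /\
  (\int[mu]_(t in `[a, b]) (speed g c t)%:E = \int[mu]_(t in `[a, b]) (speed g c' t)%:E)%E.
Proof.
move=> Cc' cc'.
have mc' : measurable_fun `]a, b[ (speed g c').
  by apply: measurable_funTS; apply: continuous_measurable_fun; exact: speed_continuous.
have E : {in `]a, b[, speed g c =1 speed g c'}.
  by move=> t /[!in_itv]/= tab; exact: speed_piece cc'.
have mc : measurable_fun `]a, b[ (speed g c).
  by apply: eq_measurable_fun mc' => t; rewrite inE /= => tab; rewrite E.
split; first exact: measurable_fun_itv_cc mc.
by apply: eq_integral_itv_bounded.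
Qed.

Lemma sdist_piece (c c' : R -> M) (a b : R) : a < b ->
  C1_curve A c' -> {in `[a, b], c =1 c'} ->
  ((sdist e (c a) (c b))%:E <= (#|sf_idx e|%:R * sf_cst e)%:E *
    \int[mu]_(t in `[a, b]) (speed g c t)%:E)%E.
Proof.
move=> ab Cc' cc'; have [_ ->] := speed_piece_integral Cc' cc'.
have -> : c a = c' a by apply: cc'; rewrite in_itv /= lexx ltW.
have -> : c b = c' b by apply: cc'; rewrite in_itv /= lexx ltW.
exact: sdist_C1_curve.
Qed.

Lemma sdist_piecewise_path (c : R -> M) (s : seq R) (a : R) :
  path <%O a s -> (forall i, (i < size s)%N -> exists2 c' : R -> M, C1_curve A c' &
      {in `[nth 0 (a :: s) i, nth 0 s i], c =1 c'}) ->
  measurable_fun `[a, last a s] (speed g c) /\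
  ((sdist e (c a) (c (last a s)))%:E <= (#|sf_idx e|%:R * sf_cst e)%:E *
    \int[mu]_(t in `[a, last a s]) (speed g c t)%:E)%E.
Proof.
have K0 : 0 <= #|sf_idx e|%:R * sf_cst e by rewrite mulr_ge0 ?ler0n// ltW// sf_cst_gt0.
elim: s a => [|b s IH] a.
  move=> _ _ /=; split; first by rewrite set_itv1; exact: measurable_fun_set1.
  rewrite sdistxx mule_ge0 ?lee_fin//; apply: integral_ge0 => t _.
  by rewrite lee_fin speed_ge0.
rewrite [path _ _ _]/= => /andP[ab bs] H.
have [m1 i1] := IH b bs (fun i hi => H i.+1 hi).
have bl : b <= last b s by apply: (@itv_partition_le _ _ _ _ s); split.
have [c' Cc' /= cc'] := H 0%N isT.
have [m2 i2] := speed_piece_integral Cc' cc'.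
rewrite [last _ _]/=.
have [mU EU] := ge0_integral_itv_split (ltW ab) bl m2 m1 (speed_ge0 g c).
split; first exact: mU.
rewrite EU.
rewrite ge0_muleDr; first last.
- by apply: integral_ge0 => t _; rewrite lee_fin speed_ge0.
- by apply: integral_ge0 => t _; rewrite lee_fin speed_ge0.
apply: (@le_trans _ _ ((sdist e (c a) (c b))%:E + (sdist e (c b) (c (last b s)))%:E)%E).
  by rewrite -EFinD lee_fin sdist_triangle.
apply: leeD.
  exact: sdist_piece ab Cc' cc'.
exact: i1.
Qed.

Lemma sdist_riemannian_dist x y : ((sdist e x y)%:E <=
  (#|sf_idx e|%:R * sf_cst e + 1)%:E * riemannian_dist g x y)%E.
Proof.
(* The added 1 makes the factor positive, so that one may divide by it and test the infimum on each
   curve. *)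
set K := _ + 1.
have K0 : 0 < K by rewrite ltr_wpDl// mulr_ge0 ?ler0n// ltW// sf_cst_gt0.
rewrite -lee_pdivrMl//; apply: le_ereal_inf_tmp => _ [c [[s sP Hs] c0 c1] <-].
rewrite lee_pdivrMl// -c0 -c1.
have [ps /eqP ls] := sP.
have [_] := sdist_piecewise_path ps Hs; rewrite ls => /le_trans; apply.
rewrite /curve_length lee_wpmul2r//; last by rewrite lee_fin lerDl.
by apply: integral_ge0 => t _; rewrite lee_fin tnorm_ge0.
Qed.

Lemma Gamma_plus_sdist f (d : R) x y : Gamma_plus g f d x y -> forall m,
  sdist e (iter m f x) (iter m f y) <= (#|sf_idx e|%:R * sf_cst e + 1) * d.
Proof.
move=> H m; rewrite -lee_fin EFinM; apply: le_trans (sdist_riemannian_dist _ _) _.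
apply: lee_wpmul2l; last exact: H.
by rewrite lee_fin addr_ge0// mulr_ge0 ?ler0n// ltW// sf_cst_gt0.
Qed.

End PiecewiseCurves.

(** * Bending a curve near a given time *)

Section TimeBump.
Variables (R : realType) (r t1 : R).
Hypothesis r0 : 0 < r.

Definition time_bump (t : R) : R := (r ^+ 4)^-1 * pos_sqr (r ^+ 2 - (t - t1) ^+ 2).
Definition dtime_bump (t : R) : R :=
  (r ^+ 4)^-1 * (- (2 * (t - t1)) * (2 * Num.max 0 (r ^+ 2 - (t - t1) ^+ 2))).

Lemma time_bump1 : time_bump t1 = 1.
Proof.
rewrite /time_bump /pos_sqr subrr expr0n /= subr0 max_r ?sqr_ge0//.
by rewrite -exprM mulVf// expf_neq0// gt_eqF.
Qed.

Lemma time_bump_out t : r <= `|t - t1| -> time_bump t = 0.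
Proof.
move=> h; rewrite /time_bump /pos_sqr max_l ?expr0n ?mulr0// subr_le0.
rewrite -[leRHS]real_normK ?num_real// ler_pXn2r ?nnegrE//; exact: ltW.
Qed.

Lemma time_bump_is_derive (t : R) : is_derive t 1 time_bump (dtime_bump t).
Proof.
pose G (s : R) := r ^+ 2 - (s - t1) ^+ 2.
have dG : is_derive t 1 G (- (2 * (t - t1))).
  have H := is_deriveB (is_derive_cst (r ^+ 2) t (1 : R))
    (is_deriveX 2 (is_deriveB (is_derive_id t (1 : R)) (is_derive_cst t1 t (1 : R)))).
  apply: (is_derive_eq H); by rewrite subr0 sub0r expr1 /GRing.scale /= mulr1.
have := is_derive1_comp (pos_sqr_is_derive (G t)) dG.
move=> H; have := is_deriveZ (r ^+ 4)^-1 H.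
by move=> K; apply: (is_derive_eq K); rewrite /dtime_bump /GRing.scale /= mulrC [X in X * _]mulrC mulrC.
Qed.

Lemma dtime_bump_continuous : continuous dtime_bump.
Proof.
move=> t; apply: cvgM; first exact: cvg_cst.
have ct : {for t, continuous (fun s : R => s - t1)}.
  by apply: cvgB; [exact: cvg_id|exact: cvg_cst].
apply: cvgM; first by apply: cvgN; apply: cvgM; [exact: cvg_cst|exact: ct].
apply: cvgM; first exact: cvg_cst.
apply: (@continuous_max _ _ (cst 0) (fun s : R => r ^+ 2 - (s - t1) ^+ 2)); first exact: cvg_cst.
apply: cvgB; first exact: cvg_cst.
by rewrite /=; under eq_fun do rewrite expr2; apply: cvgM.
Qed.

End TimeBump.

Section LocalC1.
Variable R : realType.

Lemma Ck1_curve_comp n (W : normedModType R) (U : set 'rV[R]_n)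
    (F : 'rV[R]_n -> W) (c : R -> 'rV[R]_n) t :
  Ck 1 U F -> nbhs (c t) U -> (\forall s \near t, differentiable c s) ->
  {for t, continuous (derive1 c)} ->
  differentiable (F \o c) t /\ forall w : R, {for t, continuous ('D_w (F \o c))}.
Proof.
move=> CF Uc dc ccc; have [dF _] := CF.
have dct := nbhs_singleton dc.
have cc : {for t, continuous c} by exact: differentiable_continuous.
have Ucs : \forall s \near t, U (c s) by exact: (continuous_near erefl cc Uc).
split; first exact: differentiable_comp dct (dF _ (nbhs_singleton Uc)).
move=> w; apply: (@continuous_near_eq _ _ (fun s => 'd F (c s) (w *: derive1 c s))).
  apply: filterS2 dc Ucs => s dcs Us.
  have E : 'd c s w = w *: derive1 c s by rewrite (diff1E dcs).
  rewrite -E (deriveE _ (differentiable_comp dcs (dF _ Us))).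
  by rewrite (@diff_comp _ _ _ _ c F s dcs (dF _ Us)).
apply: (Ck1_diff_continuous CF Uc cc).
by apply: cvgZ; [exact: cvg_cst|exact: ccc].
Qed.

Lemma derive_continuous_near_eq (V W : normedModType R) (F G : V -> W) t :
  (\forall s \near t, F s = G s) ->
  differentiable F t -> (forall w, {for t, continuous ('D_w F)}) ->
  differentiable G t /\ forall w, {for t, continuous ('D_w G)}.
Proof.
move=> FG dF cF; split; first by have [] := differentiable_near_eq FG dF.
move=> w; apply: continuous_near_eq (cF w).
by apply: filterS (near_join FG) => s; exact: near_eq_derive.
Qed.

End LocalC1.

Section Perturbation.
Variables (R : realType) (n : nat) (M : ptopologicalType).
Variables (A : smooth_atlas R n M) (g : riemannian_metric A).
Local Notation phi a := (cmap (charts (s := A) a)).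
Local Notation psi a := (cinv (charts (s := A) a)).
Local Notation dom a := (cdom (charts (s := A) a)).

Variables (c : R -> M) (t1 r : R) (a : cidx A).
Hypothesis Cc : C1_curve A c.
Hypothesis r0 : 0 < r.
Hypothesis rdom : forall t, `|t - t1| <= r -> dom a (c t).

(** At time [t1] the coordinates are shifted by the full [v], outside the window not at all; as [v]
    runs through small vectors, the point at time [t1] sweeps a neighbourhood. *)
Definition bent_coord (v : 'rV[R]_n) (t : R) : 'rV[R]_n :=
  phi a (c t) + time_bump r t1 t *: v.

Definition dbent_coord (v : 'rV[R]_n) (t : R) : 'rV[R]_n :=
  derive1 (phi a \o c) t + dtime_bump r t1 t *: v.

(** Outside the window [c] may leave the chart, where [bent_coord] is meaningless, hence the case
    distinction; both formulas agree where [c] is in the chart and the window is left. *)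
Definition bent_curve (v : 'rV[R]_n) (t : R) : M :=
  if `|t - t1| < r then psi a (bent_coord v t) else c t.

Lemma curve_dom_near t : dom a (c t) -> \forall s \near t, dom a (c s).
Proof.
have [cc _] := Cc => ac.
exact: continuous_near (erefl (c t)) (cc t) (cdom_nbhs ac).
Qed.

Lemma bent_coord_derive v t : dom a (c t) ->
  differentiable (bent_coord v) t /\ derive1 (bent_coord v) t = dbent_coord v t.
Proof.
move=> ac; have [d1 _] := C1_curve_chart Cc ac.
have i1 : is_derive t 1 (phi a \o c) (derive1 (phi a \o c) t).
  by rewrite derive1E; exact/derivableP/diff_derivable.
have [d2 e2] := time_bump_is_derive r t1 t.
have d2' : differentiable (time_bump r t1) t by exact/derivable1_diffP.
have d3 := differentiableZl v d2'.
have i3 : is_derive t 1 (fun s => time_bump r t1 s *: v) (dtime_bump r t1 t *: v).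
  apply: DeriveDef; first exact: diff_derivable.
  rewrite deriveE// diffZl//= (diff1E d2') derive1E e2.
  by rewrite /GRing.scale /= mul1r.
have i4 : is_derive t 1 (bent_coord v) (dbent_coord v t) by exact: is_deriveD i1 i3.
split; first by apply/derivable1_diffP; case: i4.
by rewrite derive1E; case: i4.
Qed.

Lemma bent_coord_continuous t (v0 : 'rV[R]_n) : dom a (c t) ->
  {for (t, v0), continuous (fun tv : R * 'rV[R]_n => bent_coord tv.2 tv.1)} /\
  {for (t, v0), continuous (fun tv : R * 'rV[R]_n => dbent_coord tv.2 tv.1)}.
Proof.
move=> ac; have [d1 c1] := C1_curve_chart Cc ac.
have cf : {for (t, v0), continuous (fst : R * 'rV[R]_n -> R)} by exact: cvg_fst.
have cs : {for (t, v0), continuous (snd : R * 'rV[R]_n -> 'rV[R]_n)} by exact: cvg_snd.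
have [d2 e2] := time_bump_is_derive r t1 t.
have ct : {for t, continuous (time_bump r t1)}.
  by apply/differentiable_continuous/derivable1_diffP.
split; apply: cvgD.
- apply: (@continuous_comp _ _ _ fst (phi a \o c)); first exact: cf.
  exact: differentiable_continuous.
- apply: cvgZ; last exact: cs.
  by apply: (@continuous_comp _ _ _ fst (time_bump r t1)); first exact: cf.
- by apply: (@continuous_comp _ _ _ fst (derive1 (phi a \o c))); first exact: cf.
- apply: cvgZ; last exact: cs.
  apply: (@continuous_comp _ _ _ fst (dtime_bump r t1)); first exact: cf.
  exact: dtime_bump_continuous.
Qed.

(** For [v = 0] the left side is the speed of [c]; continuity in time and [v], with compactness of
    the window, makes the comparison uniform in time. *)
Lemma bent_coord_near (eps : R) : 0 < eps ->
  \forall v \near (0 : 'rV[R]_n), forall t, `|t - t1| <= r ->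
    (phi a @` dom a) (bent_coord v t) /\
    chart_norm g a (bent_coord v t) (dbent_coord v t) <= speed g c t + eps.
Proof.
move=> e0; have := @segment_compact R (t1 - r) (t1 + r).
rewrite compact_near_coveringP.
pose P (v : 'rV[R]_n) (t : R) := (phi a @` dom a) (bent_coord v t) /\
    chart_norm g a (bent_coord v t) (dbent_coord v t) <= speed g c t + eps.
have inI t : (`|t - t1| <= r) = (t \in `[t1 - r, t1 + r]).
  by rewrite in_itv /= ler_distl.
move=> /(_ _ (nbhs (0 : 'rV[R]_n)) P _) H.
suff /H : forall t, [set` `[t1 - r, t1 + r]] t ->
    \forall t' \near t & v \near (0 : 'rV[R]_n), P v t'.
  by apply: filterS => v Hv t; rewrite inI; exact: Hv.
move=> t /=; rewrite -inI => /rdom ac.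
have [cb cdb] := bent_coord_continuous 0 ac.
have b0 : bent_coord 0 t = phi a (c t) by rewrite /bent_coord scaler0 addr0.
have db0 : dbent_coord 0 t = derive1 (phi a \o c) t by rewrite /dbent_coord scaler0 addr0.
have [cc _] := Cc.
have im0 : (phi a @` dom a) (bent_coord 0 t) by rewrite b0; exists (c t).
have imn : nbhs (bent_coord 0 t) (phi a @` dom a) by rewrite b0; exact: cimage_nbhs.
have cN := chart_norm_continuous (g := g) cb cdb im0.
have cS : {for (t, 0 : 'rV[R]_n), continuous (fun tv : R * 'rV[R]_n =>
    chart_norm g a (bent_coord tv.2 tv.1) (dbent_coord tv.2 tv.1) - speed g c tv.1)}.
  apply: cvgB; first exact: cN.
  apply: (@continuous_comp _ _ _ fst (speed g c)); first exact: cvg_fst.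
  exact: speed_continuous.
have z0 : chart_norm g a (bent_coord 0 t) (dbent_coord 0 t) - speed g c t < eps.
  have [d1 _] := C1_curve_chart Cc ac.
  by rewrite b0 db0 (speed_chart g (cc t) ac d1) subrr.
have N1 : \forall tv \near (t, 0 : 'rV[R]_n), chart_norm g a (bent_coord tv.2 tv.1)
    (dbent_coord tv.2 tv.1) - speed g c tv.1 < eps by exact: cvgr_lt cS _ z0.
have N2 := continuous_near (erefl _) cb imn.
have [[U V] /= [Ut V0] UV] : \forall tv \near (t, 0 : 'rV[R]_n),
    chart_norm g a (bent_coord tv.2 tv.1) (dbent_coord tv.2 tv.1) - speed g c tv.1 < eps
    /\ (phi a @` dom a) (bent_coord tv.2 tv.1) by exact: filterI N1 N2.
exists (U, V) => //= -[t' v] /= [Ut' Vv].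
have /= [h1 h2] := UV (t', v) (conj Ut' Vv).
split; first exact: h2.
by rewrite -lerBlDl ltW.
Qed.

Section FixedBend.
Variables (v : 'rV[R]_n).
Hypothesis vdom : forall t, `|t - t1| <= r -> (phi a @` dom a) (bent_coord v t).

Lemma bent_coord_out t : r <= `|t - t1| -> bent_coord v t = phi a (c t).
Proof. by move=> h; rewrite /bent_coord time_bump_out// scale0r addr0. Qed.

Lemma bent_coord_image t : dom a (c t) -> (phi a @` dom a) (bent_coord v t).
Proof.
move=> ac; have [h|h] := leP `|t - t1| r; first exact: vdom.
by rewrite bent_coord_out ?(ltW h)//; exists (c t).
Qed.

Lemma bent_curveE t : dom a (c t) -> bent_curve v t = psi a (bent_coord v t).
Proof.
move=> ac; rewrite /bent_curve; case: ltP => // h.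
by rewrite bent_coord_out// cmapK.
Qed.

Lemma bent_curve_near_in t : dom a (c t) ->
  \forall s \near t, psi a (bent_coord v s) = bent_curve v s.
Proof. by move=> /curve_dom_near; apply: filterS => s /bent_curveE. Qed.

Lemma bent_curve_near_out t : r < `|t - t1| ->
  \forall s \near t, c s = bent_curve v s.
Proof.
move=> h.
have cd : {for t, continuous (fun s : R => `|s - t1|)}.
  apply: (@continuous_comp _ _ _ (fun s : R => s - t1) Num.norm).
    by apply: cvgB; [exact: cvg_id|exact: cvg_cst].
  exact: norm_continuous.
have : \forall s \near t, r < `|s - t1| by exact: cvgr_gt cd _ h.
by apply: filterS => s hs; rewrite /bent_curve ltNge (ltW hs).
Qed.

Lemma bent_curve_out t : ~ dom a (c t) -> r < `|t - t1|.
Proof. by move=> nac; rewrite ltNge; apply/negP => /rdom. Qed.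

Lemma bent_curve_dom t : dom a (c t) -> dom a (bent_curve v t) /\
  phi a (bent_curve v t) = bent_coord v t.
Proof.
move=> ac; rewrite bent_curveE//; have [z az <-] := bent_coord_image ac.
by rewrite cmapK.
Qed.

Lemma bent_coord_continuous_fixed t : dom a (c t) -> {for t, continuous (bent_coord v)}.
Proof. by move=> ac; apply/differentiable_continuous; have [] := bent_coord_derive v ac. Qed.

(** By [rdom] every time satisfies [dom a (c t)] or [r < |t - t1|]. Both conditions are open: in the
    first case the curve is locally the chart curve [bent_coord], in the second it is locally [c].
    The boundary of the window belongs to the first case. *)
Lemma bent_curve_C1 : C1_curve A (bent_curve v).
Proof.
have [cc Ccc] := Cc; split.
  move=> t; have [ac|/bent_curve_out nac] := pselect (dom a (c t)); last first.
    exact: continuous_near_eq (bent_curve_near_out nac) (cc t).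
  apply: (continuous_near_eq (bent_curve_near_in ac)).
  apply: (@continuous_comp _ _ _ (bent_coord v) (psi a)).
    exact: bent_coord_continuous_fixed.
  exact/cinv_continuous/bent_coord_image.
move=> b.
suff H t : dom b (bent_curve v t) -> differentiable (phi b \o bent_curve v) t /\
    forall w : R, {for t, continuous ('D_w (phi b \o bent_curve v))}.
  by split=> [t /H[]//|w t /H[]].
have [ac|/bent_curve_out nac] := pselect (dom a (c t)); last first.
  have H := bent_curve_near_out nac; rewrite -(nbhs_singleton H) => bc.
  apply: (derive_continuous_near_eq (F := phi b \o c)).
  - by apply: filterS H => s /= ->.
  - by have [d _] := Ccc b; exact: d.
  - by move=> w; have [_ d] := Ccc b; exact: d.
move=> bc; have [ab pE] := bent_curve_dom ac.
have [CF nF] := transition_C1 ab bc.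
rewrite pE in nF.
have dn : \forall s \near t, differentiable (bent_coord v) s.
  by apply: filterS (curve_dom_near ac) => s acs; have [] := bent_coord_derive v acs.
have cd : {for t, continuous (derive1 (bent_coord v))}.
  apply: (@continuous_near_eq _ _ (dbent_coord v)).
    by apply: filterS (curve_dom_near ac) => s acs; have [_ ->] := bent_coord_derive v acs.
  have [_ c1] := C1_curve_chart Cc ac.
  apply: cvgD; first exact: c1.
  by apply: cvgZ; [exact: dtime_bump_continuous|exact: cvg_cst].
have [d1 d2] := Ck1_curve_comp CF nF dn cd.
apply: (derive_continuous_near_eq (F := (phi b \o psi a) \o bent_coord v)).
- by apply: filterS (bent_curve_near_in ac) => s /= <-.
- exact: d1.
- exact: d2.
Qed.

Lemma bent_curve_speed t : dom a (c t) ->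
  speed g (bent_curve v) t = chart_norm g a (bent_coord v t) (dbent_coord v t).
Proof.
move=> ac; have [ab pE] := bent_curve_dom ac.
have [cb _] := bent_curve_C1.
have [d1 _] := C1_curve_chart bent_curve_C1 ab.
rewrite (speed_chart g (cb t) ab d1) pE; congr (chart_norm _ _ _ _).
have [_ <-] := bent_coord_derive v ac.
rewrite !derive1E; apply: near_eq_derive.
by apply: filterS (curve_dom_near ac) => s /bent_curve_dom[].
Qed.

End FixedBend.

End Perturbation.

Section MoveEndpoint.
Variables (R : realType) (n : nat) (M : ptopologicalType).
Variables (A : smooth_atlas R n M) (g : riemannian_metric A).

Lemma move_endpoint (c : R -> M) (t1 d eps : R) : C1_curve A c -> 0 < d -> 0 < eps ->
  \forall y \near c t1, exists c' : R -> M, [/\ C1_curve A c',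
    forall t, t <= t1 - d -> c' t = c t, c' t1 = y &
    forall t, t <= t1 -> speed g c' t <= speed g c t + eps].
Proof.
move=> Cc d0 e0; have [cc _] := Cc.
pose a := chart_idx A (c t1); have ac : cdom (charts a) (c t1) by exact: chart_idxP.
have /nbhs_ballP[rho /= rho0 Hrho] := curve_dom_near Cc ac.
(* [rho / 2] keeps the closed window inside the chart, and [d] confines the change to times after
   [t1 - d]. *)
pose r := Num.min (rho / 2) d.
have r0 : 0 < r by rewrite lt_min divr_gt0.
have rd : r <= d by rewrite ge_min lexx orbT.
have rdom t : `|t - t1| <= r -> cdom (charts a) (c t).
  move=> h; apply: Hrho; rewrite -ball_normE /= distrC (le_lt_trans h)//.
  by rewrite gt_min ltr_pdivrMr// ltr_pMr// ltr1n.
have N := bent_coord_near g Cc rdom e0.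
have cphi : {for c t1, continuous (fun y => cmap (charts a) y - cmap (charts a) (c t1))}.
  by apply: cvgB; [exact: cmap_continuous|exact: cvg_cst].
have cphi0 : cmap (charts a) (c t1) - cmap (charts a) (c t1) = 0 by rewrite subrr.
have N' := continuous_near (f := fun y => cmap (charts a) y - cmap (charts a) (c t1)) cphi0 cphi N.
apply: filterS2 N' (cdom_nbhs ac) => y Hy ay.
set v := _ - _ in Hy.
have vdom t : `|t - t1| <= r -> (cmap (charts a) @` cdom (charts a)) (bent_coord c t1 r a v t).
  by move=> /Hy[].
exists (bent_curve c t1 r a v); split.
- exact: bent_curve_C1.
- move=> t ht; rewrite /bent_curve ltNge.
  suff -> : r <= `|t - t1| by [].
  by rewrite (le_trans rd)// distrC (le_trans _ (ler_norm _))// lerBrDr addrC -lerBrDr.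
- rewrite /bent_curve subrr normr0 r0 /bent_coord time_bump1// scale1r.
  by rewrite addrC subrK cmapK.
- move=> t _; have [h|h] := leP `|t - t1| r.
    rewrite (bent_curve_speed g Cc r0 rdom vdom (rdom t h)).
    by have [_] := Hy t h.
  by rewrite -(speed_near_eq g (bent_curve_near_out _ _ _ h)) lerDl ltW.
Qed.

End MoveEndpoint.

(** * Openness of Riemannian balls *)

Section DistanceOpen.
Variables (R : realType) (n : nat) (M : ptopologicalType).
Variables (A : smooth_atlas R n M) (g : riemannian_metric A).
Variable e : separating_family g.
Local Notation mu := (@lebesgue_measure R).

Lemma nth_le_last_path (s : seq R) (a : R) i : path <%O a s -> (i < size s)%N ->
  nth 0 s i <= last a s.
Proof.
move=> ps si; have ss : sorted <=%R s.
  by apply: path_sorted; apply: sub_path ps => x y; exact: ltW.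
have -> : last a s = nth 0 s (size s).-1 by rewrite -nth_last; apply: set_nth_default; rewrite prednK// (leq_ltn_trans _ si).
apply: (sorted_leq_nth le_trans le_refl 0 ss); rewrite ?inE//.
  by rewrite prednK// (leq_ltn_trans _ si).
by rewrite -ltnS prednK// (leq_ltn_trans _ si).
Qed.

Lemma ge0_integral_le_add (h h' : R -> R) (eps : R) :
  measurable_fun [set` `[0 : R, 1]] h -> measurable_fun [set` `[0 : R, 1]] h' ->
  (forall t, 0 <= h t) -> (forall t, 0 <= h' t) -> 0 <= eps ->
  (forall t, 0 <= t < 1 -> h' t <= h t + eps) ->
  (\int[mu]_(t in `[0%R, 1%R]) (h' t)%:E
    <= \int[mu]_(t in `[0%R, 1%R]) (h t)%:E + eps%:E)%E.
Proof.
move=> mc mc' h0 h'0 e0 H.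
(* The pointwise bound is assumed only before time 1, where the speed may be junk; dropping this
   endpoint does not change the integrals. *)
have sub : [set` `[0 : R, 1[] `<=` [set` `[0 : R, 1]].
  by move=> t /=; rewrite !in_itv /= => /andP[-> /ltW ->].
have mco : measurable_fun [set` `[0 : R, 1[] h by exact: measurable_funS mc.
have mco' : measurable_fun [set` `[0 : R, 1[] h' by exact: measurable_funS mc'.
rewrite -integral_itv_bndo_bndc; last exact/measurable_EFinP.
rewrite -integral_itv_bndo_bndc; last exact/measurable_EFinP.
have mm : (\int[mu]_(t in `[0%R, 1%R[) (cst eps%:E t) = eps%:E)%E.
  by rewrite integral_cst//= lebesgue_measure_itv/= lte_fin ltr01 oppr0 adde0 mule1.
rewrite -[X in (_ <= _ + X)%E]mm -ge0_integralD//; first last.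
- exact/measurable_EFinP.
- by move=> t _; rewrite lee_fin.
apply: ge0_le_integral => //.
- by move=> t _; rewrite lee_fin.
- exact/measurable_EFinP.
- by apply: emeasurable_funD => //; exact/measurable_EFinP.
Qed.

Lemma curve_length_le (c c' : R -> M) (eps : R) :
  measurable_fun [set` `[0 : R, 1]] (speed g c) ->
  measurable_fun [set` `[0 : R, 1]] (speed g c') ->
  0 <= eps ->
  (forall t, 0 <= t < 1 -> speed g c' t <= speed g c t + eps) ->
  (curve_length g c' <= curve_length g c + eps%:E)%E.
Proof.
move=> mc mc'.
exact: (ge0_integral_le_add mc mc' (speed_ge0 g c) (speed_ge0 g c')).
Qed.

Lemma piecewise_C1_speed_measurable (c : R -> M) : piecewise_C1 A c ->
  measurable_fun [set` `[0 : R, 1]] (speed g c).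
Proof.
move=> [s [ps /eqP ls] Hs]; have [] := sdist_piecewise_path e ps Hs.
by rewrite ls.
Qed.

(* Only the last piece is bent, near time 1: this shows that the balls of
   [riemannian_dist] are open without concatenating curves. *)
Lemma move_piecewise_endpoint (c : R -> M) (eps : R) : piecewise_C1 A c -> 0 < eps ->
  \forall y \near c 1, exists c', [/\ piecewise_C1 A c', c' 0 = c 0, c' 1 = y &
    forall t, 0 <= t < 1 -> speed g c' t <= speed g c t + eps].
Proof.
move=> [s [ps ls] Hs] e0; move: ps ls Hs.
case/lastP: s => [|s x]; first by move=> _ /= /eqP E; have := @oner_neq0 R; rewrite -E eqxx.
rewrite last_rcons rcons_path => /andP[ps a1] /eqP x1 Hs.
rewrite {}x1 in a1 Hs *.
set a := last 0 s in a1.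
have [e0' Ce0 /=] : exists2 c0 : R -> M, C1_curve A c0 & {in `[a, 1], c =1 c0}.
  have := Hs (size s); rewrite size_rcons ltnSn -rcons_cons nth_rcons /= ltnSn.
  rewrite nth_rcons ltnn eqxx.
  have -> : nth 0 (0 :: s) (size s) = a by rewrite /a (last_nth 0).
  exact.
move=> ce0.
pose d := (1 - a) / 2.
have d0 : 0 < d by rewrite divr_gt0// subr_gt0.
have ad : a < 1 - d by rewrite /d; lra.
have d1 : 1 - d < 1 by rewrite gtrBl.
have a0 : 0 <= a by apply: (@itv_partition_le _ _ _ _ s); split.
have c1E : c 1 = e0' 1 by apply: ce0; rewrite in_itv /= lexx ltW.
rewrite c1E.
apply: filterS (move_endpoint g 1 Ce0 d0 e0) => y [c2 [Cc2 c2e c21 c2s]].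
(* The two formulas agree on [[a, 1 - d]], so on the last piece [c'] is the single C^1 curve [c2],
   and the partition is unchanged. *)
pose c' t := if t <= 1 - d then c t else c2 t.
have c'c t : t <= 1 - d -> c' t = c t by rewrite /c' => ->.
have c'c2 : {in `[a, 1], c' =1 c2}.
  move=> t /[!in_itv]/= /andP[at_ t1]; rewrite /c'; case: ifP => // td.
  by rewrite (ce0 t) ?in_itv/= ?at_// c2e.
exists c'; split.
- exists (rcons s 1).
    by split; rewrite ?last_rcons// rcons_path ps.
  move=> i; rewrite size_rcons ltnS leq_eqVlt => /orP[/eqP ->|si].
    exists c2 => //; rewrite -rcons_cons nth_rcons /= ltnSn nth_rcons ltnn eqxx.
    have -> : nth 0 (0 :: s) (size s) = a by rewrite /a (last_nth 0).
    exact: c'c2.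
  have [|ci Ci cci] := Hs i; first by rewrite size_rcons ltnS ltnW.
  exists ci => // t tI; rewrite c'c; first exact: cci.
  move: tI; rewrite in_itv /= => /andP[_]; rewrite nth_rcons si => /le_trans; apply.
  by apply: le_trans (ltW ad); exact: nth_le_last_path.
- by rewrite c'c// (le_trans a0)// ltW.
- by rewrite /c' leNgt d1.
- move=> t /andP[t0 t1]; have [td|dt] := ltP t (1 - d).
    have -> : speed g c' t = speed g c t.
      apply: speed_near_eq; near=> s'; apply: c'c; apply/ltW; near: s'.
      exact: lt_nbhsl.
    by rewrite lerDl ltW.
  have at1 : a < t < 1 by rewrite t1 (lt_le_trans ad).
  rewrite (speed_piece g at1 c'c2) (speed_piece g at1 ce0).
  by apply: c2s; rewrite ltW.
Unshelve. all: by end_near. Qed.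

Lemma riemannian_dist_le_length (c : R -> M) : piecewise_C1 A c ->
  (riemannian_dist g (c 0%R) (c 1%R) <= curve_length g c)%E.
Proof.
move=> pc; apply: ge_ereal_inf; exists (curve_length g c); last exact: lexx.
by exists c.
Qed.

Lemma riemannian_dist_lt_open z (r : R) :
  open [set y | (riemannian_dist g z y < r%:E)%E].
Proof.
rewrite openE => y /= /ereal_inf_lt[_ [c [pc c0 c1] <-] lr].
have L0 : (0 <= curve_length g c)%E.
  by apply: integral_ge0 => t _; rewrite lee_fin tnorm_ge0.
have [l lE] : exists l, curve_length g c = l%:E.
  by exists (fine (curve_length g c)); rewrite fineK// ge0_fin_numE// (lt_trans lr)// ltry.
rewrite lE lte_fin in lr.
have e0 : 0 < (r - l) / 2 by rewrite divr_gt0// subr_gt0.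
rewrite /interior -c1; apply: filterS (move_piecewise_endpoint pc e0) => y' [c' [pc' c'0 c'1 sp]].
have len : (curve_length g c' <= curve_length g c + ((r - l) / 2)%:E)%E.
  apply: curve_length_le => //; [exact: piecewise_C1_speed_measurable|
    exact: piecewise_C1_speed_measurable|exact: ltW].
apply: (@le_lt_trans _ _ (curve_length g c')).
  by rewrite -c0 -c'0 -c'1; exact: riemannian_dist_le_length.
apply: (le_lt_trans len); rewrite lE -EFinD lte_fin.
by lra.
Qed.

End DistanceOpen.

(** * Borel measurability *)

Section GammaMeasurable.
Variables (R : realType) (n : nat) (M : ptopologicalType).
Variables (A : smooth_atlas R n M) (g : riemannian_metric A).
Variable e : separating_family g.

Lemma open_borel (U : set M) : open U -> measurable (U : set (borel M)).
Proof. by move=> oU; exact: sub_sigma_algebra. Qed.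

Lemma closed_borel (U : set M) : closed U -> measurable (U : set (borel M)).
Proof.
move=> cU; rewrite -[U]setCK; apply: measurableC; apply: open_borel.
exact: closed_openC.
Qed.

Lemma continuous_borel (f : M -> M) : continuous f ->
  forall B : set (borel M), measurable B -> measurable (f @^-1` B : set (borel M)).
Proof.
move=> cf B mB.
have mf : measurable_fun [set: borel M] (f : borel M -> borel M).
  apply: (@measurability _ _ (borel M) (borel M) setT f (@open M)); first by [].
  move=> _ [U oU <-]; rewrite setTI; apply: open_borel.
  by apply: open_comp => // x _; exact: cf.
by have := mf measurableT B mB; rewrite setTI.
Qed.

Lemma iter_continuous (f : M -> M) m : continuous f -> continuous (iter m f).
Proof.
move=> cf; elim: m => [|m IH] x; first exact: cvg_id.
by apply: (@continuous_comp _ _ _ (iter m f) f); [exact: IH|exact: cf].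
Qed.

(** Openness is available for strict sublevel sets of the distance, so the bound [d] is approached
    by the strict bounds [d + 1 / (k + 1)], giving a countable intersection of open sets. *)
Lemma Gamma_plus_measurable f (d : R) x : continuous f ->
  measurable (Gamma_plus g f d x : set (borel M)).
Proof.
move=> cf.
have -> : Gamma_plus g f d x = \bigcap_m \bigcap_k
    (iter m f @^-1` [set y | (riemannian_dist g (iter m f x) y < (d + k.+1%:R^-1)%:E)%E]).
  apply/seteqP; split=> [y H m _ k _ /=|y H m].
    by apply: (le_lt_trans (H m)); rewrite lte_fin ltrDl.
  apply/lee_addgt0Pr => eps e0.
  pose k := Num.truncn eps^-1.
  have := H m I k I => /= /ltW /le_trans; apply.
  rewrite -EFinD lee_fin lerD2l -[leRHS]invrK lef_pV2 ?posrE ?invr_gt0//.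
  exact/ltW/truncnS_gt.
apply: bigcap_measurable => // m _; apply: bigcap_measurable => // k _.
apply: continuous_borel; first exact: iter_continuous.
by apply: open_borel; exact: riemannian_dist_lt_open.
Qed.

End GammaMeasurable.

Lemma near_forall (T : topologicalType) (I : finType) (P : I -> T -> Prop) (t : T) :
  (forall i, \forall s \near t, P i s) -> \forall s \near t, forall i, P i s.
Proof. exact: filter_forall. Qed.

Lemma eq_continuous_at (T T' : topologicalType) (f g : T -> T') (t : T) :
  f =1 g -> {for t, continuous f} -> {for t, continuous g}.
Proof. by move=> /funext ->. Qed.

Lemma continuous_finite_sum (R : realType) (V : normedModType R) (I : Type) (r : seq I)
    (T : topologicalType) (f : I -> T -> V) (t : T) :
  (forall i, {for t, continuous (f i)}) ->
  {for t, continuous (fun s => \sum_(i <- r) f i s)}.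
Proof. by move=> H; apply: cvg_finite_sum. Qed.

(** * Pointwise expansion from positive exponents *)

Section PointwiseExpansion.
Variables (R : realType) (n : nat) (M : ptopologicalType).
Variables (A : smooth_atlas R n M) (g : riemannian_metric A).
Variable e : separating_family g.
Local Notation u := (@sf_fun _ _ _ _ _ e).
Hypothesis compM : compact [set: M].
Variable f : M -> M.
Hypothesis fC1 : C1_local_diffeo A f.

(** The infinitesimal form of [sdist]; it is comparable to the Riemannian norm by [fnorm_tnorm]. *)
Definition fnorm (y : M) (w : 'rV[R]_n) : R := \sum_i `|dfun A (u i) y w|.

Lemma iter_differentiable m x : differentiable
  (cmap (chart_at A (iter m f x)) \o iter m f \o cinv (chart_at A x))
  (cmap (chart_at A x) x).
Proof.
elim: m => [|m IH]; first exact: transition_differentiable (chart_idxP A x) (chart_idxP A x).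
have ax := chart_idxP A x.
have E : (iter m f \o cinv (chart_at A x)) (cmap (chart_at A x) x) = iter m f x.
  by rewrite /= cmapK.
have cm : {for cmap (chart_at A x) x, continuous (iter m f \o cinv (chart_at A x))}.
  apply: (@continuous_comp _ _ _ (cinv (chart_at A x)) (iter m f)).
    by apply: cinv_continuous; exists x.
  exact/iter_continuous/(f_continuous fC1).
have [d1 _] := differentiable_through_chart
  (G := cmap (chart_at A (iter m.+1 f x)) \o f) E (chart_idxP A (iter m f x)) cm IH
  (f_differentiable fC1 (iter m f x)).
exact: d1.
Qed.

Lemma sf_iter_differentiable i m x :
  differentiable (u i \o iter m f \o cinv (chart_at A x)) (cmap (chart_at A x) x) /\
  forall v, 'd (u i \o iter m f \o cinv (chart_at A x)) (cmap (chart_at A x) x) v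
    = dfun A (u i) (iter m f x) (v *m tangent_map A (iter m f) x).
Proof.
have ax := chart_idxP A x.
have E : (iter m f \o cinv (chart_at A x)) (cmap (chart_at A x) x) = iter m f x.
  by rewrite /= cmapK.
have cm : {for cmap (chart_at A x) x, continuous (iter m f \o cinv (chart_at A x))}.
  apply: (@continuous_comp _ _ _ (cinv (chart_at A x)) (iter m f)).
    by apply: cinv_continuous; exists x.
  exact/iter_continuous/(f_continuous fC1).
have [d1 d2] := differentiable_through_chart (G := u i)
  E (chart_idxP A (iter m f x)) cm (iter_differentiable m x)
  (@sf_differentiable _ _ _ _ _ e i (iter m f x)).
split; first exact: d1.
move=> v; apply: etrans (d2 v) _; rewrite /dfun; congr ('d _ _ _).
by rewrite /tangent_map /jacobian mul_rV_lin1.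
Qed.

(** [K] bounds the waiting time and is, up to a successor, the reciprocal of the radius, so the
    condition becomes weaker as [K] grows. [k] is the multiplicative loss. *)
Definition expansive_at (b : R) (k n0 K : nat) (x : M) : Prop := forall y,
  sdist e x y < K.+1%:R^-1 -> exists2 m, (n0 <= m <= K)%N &
    b ^+ m * sdist e x y <= k.+1%:R * sdist e (iter m f x) (iter m f y).

(** A strict inequality at one time persists for nearby vectors, so finitely many times serve the
    whole unit sphere, and homogeneity carries this to all vectors. *)
Lemma fnorm_growth_compact (b : R) x n0 :
  (forall v, v != 0 -> exists2 m, (n0 <= m)%N &
    b ^+ m < fnorm (iter m f x) (v *m tangent_map A (iter m f) x)) ->
  exists2 K, (n0 <= K)%N & forall v, exists2 m, (n0 <= m <= K)%N &
    b ^+ m * `|v| <= fnorm (iter m f x) (v *m tangent_map A (iter m f) x).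
Proof.
move=> H.
pose N m v := fnorm (iter m f x) (v *m tangent_map A (iter m f) x).
have cN m v : {for v, continuous (N m)}.
  apply: (@continuous_finite_sum R R _ _ 'rV[R]_n) => i.
  have [d1 d2] := sf_iter_differentiable i m x.
  apply: (@eq_continuous_at 'rV[R]_n _ (fun v => `|'d (u i \o iter m f \o cinv (chart_at A x)) (cmap (chart_at A x) x) v|)).
    by move=> w; congr (`|_|); exact: d2.
  apply: (@continuous_comp _ _ _ ('d (u i \o iter m f \o cinv (chart_at A x)) (cmap (chart_at A x) x)) Num.norm).
    exact: diff_continuous.
  exact: norm_continuous.
have NZ m (t : R) v : N m (t *: v) = `|t| * N m v.
  rewrite /N /fnorm mulr_sumr; apply: eq_bigr => i _.
  by rewrite -scalemxAl /dfun linearZ /= normrM.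
have := @compact_sphere R n; rewrite compact_near_coveringP.
pose P (K : nat) v := exists2 m, (n0 <= m <= K)%N & b ^+ m < N m v.
move=> /(_ nat \oo P _) Hc.
have {}Hc : \forall K \near \oo, [set w : 'rV[R]_n | `|w| = 1] `<=` P K.
  apply: Hc => v /= v1.
  have [|m nm hm] := H v; first by rewrite -normr_eq0 v1 oner_eq0.
  exists ([set w | b ^+ m < N m w], [set K | (m <= K)%N]).
    split=> /=; last exact: nbhs_infty_ge.
    exact: cvgr_gt (cN m v) _ hm.
  by move=> [w K] /= [hw mK]; exists m => //; rewrite nm.
have [K [n0K HK]] : exists K, (n0 <= K)%N /\ [set w : 'rV[R]_n | `|w| = 1] `<=` P K.
  near \oo => K; exists K; split; near: K; first exact: nbhs_infty_ge.
  exact: Hc.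
exists K => // v; have [->|v0] := eqVneq v 0.
  by exists n0; rewrite ?leqnn// normr0 mulr0; exact: sumr_ge0.
have nv : 0 < `|v| by rewrite normr_gt0.
have [|m mK hm] := HK (`|v|^-1 *: v).
  by rewrite /= normrZ normfV normr_id mulVf// gt_eqF.
exists m => //; move: hm; rewrite NZ normfV normr_id mulrC ltr_pdivlMr//.
exact: ltW.
Unshelve. all: by end_near. Qed.

Lemma sdist_lipschitz_at x : exists2 c : R, 0 < c & \forall y \near x,
  sdist e x y <= c * `|cmap (chart_at A x) y - cmap (chart_at A x) x|.
Proof.
have ax := chart_idxP A x.
have [c Hc] := choice (fun i => (exists2P _ _).1
  (differentiable_lipschitz_at (@sf_differentiable _ _ _ _ _ e i x))).
exists (1 + \sum_i c i).
  by rewrite ltr_pwDl// sumr_ge0// => i _; have [/ltW] := Hc i.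
have H : \forall q \near cmap (chart_at A x) x, forall i,
    `|(u i \o cinv (chart_at A x)) q - (u i \o cinv (chart_at A x)) (cmap (chart_at A x) x)|
    <= c i * `|q - cmap (chart_at A x) x|.
  by apply: (@near_forall 'rV[R]_n) => i; have [] := Hc i.
have H' := continuous_near erefl (@cmap_continuous _ _ _ _ _ ax) H.
apply: filterS2 H' (cdom_nbhs ax) => y Hy ay.
rewrite mulrDl mul1r ler_wpDl// mulr_suml; apply: ler_sum => i _.
by have := Hy i; rewrite /= !cmapK// distrC.
Qed.

Lemma expansion_from_growth (b : R) x : 1 <= b ->
  (forall v, v != 0 -> forall n0, exists2 m, (n0 <= m)%N &
    b ^+ m < fnorm (iter m f x) (v *m tangent_map A (iter m f) x)) ->
  exists k, forall n0, exists K, expansive_at b k n0 K x.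
Proof.
move=> b1 H; have ax := chart_idxP A x.
have [c c0 Hc] := sdist_lipschitz_at x.
(* [c] compares [sdist] at x with chart coordinates and the factor 2 pays for the linearisation
   error; neither depends on [n0]. *)
exists (Num.truncn (2 * c)) => n0.
have [K0 n0K0 HK0] := fnorm_growth_compact (fun v v0 => H v v0 n0).
(* Summed over all indices the error is at most [|v| / 2], which is at most half of [b ^+ m * |v|]
   because [b ^+ m] is at least 1. *)
pose eta : R := (2 * #|sf_idx e|.+1%:R)^-1.
have eta0 : 0 < eta by rewrite invr_gt0 mulr_gt0.
pose U i m := u i \o iter m f \o cinv (chart_at A x).
pose p := cmap (chart_at A x) x.
have D : \forall q \near p, forall im : sf_idx e * 'I_K0.+1,
    `|U im.1 im.2 q - U im.1 im.2 p - 'd (U im.1 im.2) p (q - p)| <= eta * `|q - p|.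
  apply: (@near_forall 'rV[R]_n) => im; apply: differentiable_le eta0.
  by have [] := sf_iter_differentiable im.1 im.2 x.
have D' := continuous_near erefl (@cmap_continuous _ _ _ _ _ ax) D.
have [d d0 Hd] := nbhs_sdist_ball e compM (filterI (filterI Hc D') (cdom_nbhs ax)).
pose K := maxn K0 (Num.truncn d^-1).
exists K => y xy.
have [|[Hcy Dy] ay] := Hd y.
  apply: (lt_le_trans xy); rewrite -[leRHS]invrK lef_pV2 ?posrE ?invr_gt0//.
  apply: ltW; apply: (lt_le_trans (truncnS_gt _)).
  by rewrite ler_nat ltnS leq_maxr.
set v := cmap (chart_at A x) y - cmap (chart_at A x) x in Hcy Dy.
have [m /andP[n0m mK0] hm] := HK0 v.
exists m; first by rewrite n0m (leq_trans mK0)// leq_maxl.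
have bm : 1 <= b ^+ m by rewrite exprn_ege1.
have up : fnorm (iter m f x) (v *m tangent_map A (iter m f) x) <=
    sdist e (iter m f x) (iter m f y) + `|v| / 2.
  have S : \sum_(i : sf_idx e) eta * `|v| <= `|v| / 2.
    rewrite sumr_const -[leLHS]mulr_natl mulrA [leLHS]mulrC ler_wpM2l//.
    rewrite /eta invfM mulrCA ger_pMr// ler_pdivrMr// mul1r ler_nat; exact: leqnSn.
  apply: le_trans (lerD (lexx _) S); rewrite /fnorm /sdist -big_split /=.
  apply: ler_sum => i _.
  have [_ dE] := sf_iter_differentiable i m x.
  have UE z : cdom (chart_at A x) z -> U i m (cmap (chart_at A x) z) = u i (iter m f z).
    by move=> az; rewrite /U /= cmapK.
  have := Dy (i, Ordinal (mK0 : (m < K0.+1)%N)).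
  rewrite [X in X -> _]/= (UE y ay) (UE x ax) => Di.
  have Di' : `|u i (iter m f y) - u i (iter m f x) - dfun A (u i) (iter m f x) (v *m tangent_map A (iter m f) x)| <= eta * `|v|.
    by apply: le_trans Di; apply: eq_leW; congr (`|_ - _|); exact/esym/dE.
  rewrite -lerBlDl; apply: le_trans Di'.
  rewrite (distrC (u i (iter m f x))) (distrC _ (dfun _ _ _ _)).
  exact: lerB_dist.
have low : b ^+ m * `|v| <= 2 * sdist e (iter m f x) (iter m f y).
  have : b ^+ m * `|v| <= sdist e (iter m f x) (iter m f y) + b ^+ m * `|v| / 2.
    apply: (le_trans (le_trans hm up)); rewrite lerD2l ler_wpM2r// ler_peMl//.
  lra.
apply: (@le_trans _ _ (b ^+ m * (c * `|v|))).
  by rewrite ler_wpM2l// exprn_ge0// (le_trans ler01).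
rewrite mulrCA; apply: (@le_trans _ _ (c * (2 * sdist e (iter m f x) (iter m f y)))).
  by rewrite ler_wpM2l// ltW.
rewrite mulrA ler_wpM2r ?sdist_ge0//.
by rewrite [c * 2]mulrC; exact/ltW/truncnS_gt.
Qed.

End PointwiseExpansion.

(** * Exponential growth rates *)

Section ExponentialRate.
Variable R : realType.

(** The limit of [ln (a m) / m] written without logarithms, so that [a m] is visibly positive for
    large m and sums can be estimated directly. *)
Definition exp_rate (a : nat -> R) (lam : R) : Prop := forall eps, 0 < eps ->
  \forall m \near \oo, expR (m%:R * (lam - eps)) <= a m <= expR (m%:R * (lam + eps)).

Lemma expR_near_ge (c d : R) : 0 < d -> \forall m \near \oo, c <= expR (m%:R * d).
Proof.
move=> d0; apply: filterS (nbhs_infty_ger (c / d)) => m.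
rewrite ler_pdivrMr// => h; apply: (le_trans h).
by apply: le_trans (expR_ge1Dx _); rewrite lerDr.
Qed.

Lemma exp_rate_lim (t : nat -> R) (lam : R) : 0 < lam ->
  (fun m : nat => m%:R^-1 * ln (t m)) @ \oo --> lam -> exp_rate t lam.
Proof.
move=> lam0 tlim eps eps0.
have e0 : 0 < Num.min eps (lam / 2) by rewrite lt_min eps0 divr_gt0.
have H : \forall m \near \oo, `|lam - m%:R^-1 * ln (t m)| < Num.min eps (lam / 2).
  by move: tlim => /cvgrPdist_lt /(_ _ e0).
apply: filterS2 H (nbhs_infty_gt 0) => m.
rewrite distrC ltr_distl => /andP[h1 h2] m0.
have m0' : 0 < m%:R :> R by rewrite ltr0n.
have ht (x : R) : m%:R^-1 * ln (t m) < x -> ln (t m) <= m%:R * x.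
  by move=> hx; rewrite -ler_pdivrMl// ltW.
have hl (x : R) : x < m%:R^-1 * ln (t m) -> m%:R * x < ln (t m).
  by move=> hx; rewrite -ltr_pdivlMl.
(* At nonpositive arguments [ln] takes the default value 0; the quotient would be 0, against its
   lower bound, which is at least [lam / 2]. *)
have tm0 : 0 < t m.
  rewrite ltNge; apply/negP => /ln0 E; have := hl _ h1; rewrite E => /ltW.
  rewrite leNgt => /negP; apply; apply: mulr_gt0 => //; rewrite subr_gt0.
  by rewrite gt_min [X in _ || X]ltr_pdivrMr// [X in _ || X]ltr_pMr// ltr1n orbT.
rewrite -[t m]lnK ?posrE// !ler_expR; apply/andP; split.
  apply/ltW/hl/(le_lt_trans _ h1); rewrite lerB//.
  by rewrite ge_min lexx.
by apply/ht/(lt_le_trans h2); rewrite lerD2l ge_min lexx.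
Qed.

Lemma exp_rate_comparable (t a : nat -> R) (c lam : R) : 0 < c ->
  (forall m, t m <= c * a m) -> (forall m, a m <= c * t m) ->
  exp_rate t lam -> exp_rate a lam.
Proof.
move=> c0 ta at_ Ht eps eps0; have e2 : 0 < eps / 2 by rewrite divr_gt0.
apply: filterS2 (Ht _ e2) (expR_near_ge c e2) => m /andP[h1 h2] hc.
have Ep : m%:R * (lam + eps) = m%:R * (eps / 2) + m%:R * (lam + eps / 2) by field.
have Em : m%:R * (lam - eps / 2) = m%:R * (eps / 2) + m%:R * (lam - eps) by field.
apply/andP; split; last first.
  rewrite Ep expRD (le_trans (at_ m))// ler_pM ?(ltW c0)//.
  by apply: le_trans h1; exact: expR_ge0.
rewrite -(ler_pM2l c0); apply: le_trans (ta m); apply: le_trans h1.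
by rewrite Em expRD ler_wpM2r ?expR_ge0.
Qed.

(** To be read with [a], [b], [c] the norms of two vectors and of their sum, the hypotheses being
    triangle inequalities: the faster rate wins. *)
Lemma exp_rate_dominant (a b c : nat -> R) (lam kap : R) : lam < kap ->
  (forall m, c m <= a m + b m) -> (forall m, b m <= a m + c m) ->
  exp_rate a lam -> exp_rate b kap -> exp_rate c kap.
Proof.
move=> lk cab bac Ha Hb eps eps0.
(* For large m a factor 2 costs [d] in the exponent; two such losses fit into [eps], and three fit
   between [lam] and [kap]. *)
pose d := Num.min (eps / 2) ((kap - lam) / 4).
have d0 : 0 < d by rewrite lt_min !divr_gt0// subr_gt0.
have de : 2 * d <= eps.
  rewrite mulrC -ler_pdivlMr// /d.
  by rewrite ge_min lexx.
have dk : 4 * d <= kap - lam.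
  by rewrite mulrC -ler_pdivlMr// /d ge_min lexx orbT.
apply: filterS3 (Ha _ d0) (Hb _ d0) (expR_near_ge 2 d0) => m /andP[_ a2] /andP[b1 b2] h2.
have m0 : 0 <= m%:R :> R by rewrite ler0n.
have step (x : R) : 2 * expR (m%:R * x) <= expR (m%:R * (x + d)).
  by rewrite mulrDr addrC expRD ler_wpM2r ?expR_ge0.
have mono (x y : R) : x <= y -> expR (m%:R * x) <= expR (m%:R * y).
  by move=> xy; rewrite ler_expR ler_wpM2l.
have a2' : 2 * a m <= expR (m%:R * (kap - d)).
  apply: le_trans (_ : 2 * expR (m%:R * (lam + d)) <= _); first by rewrite ler_pM2l.
  apply: (le_trans (step _)); apply: mono; lra.
apply/andP; split.
  have : 2 * expR (m%:R * (kap - eps)) <= expR (m%:R * (kap - d)).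
    by apply: (le_trans (step _)); apply: mono; lra.
  have := bac m; lra.
have : 2 * expR (m%:R * (kap + d)) <= expR (m%:R * (kap + eps)).
  by apply: (le_trans (step _)); apply: mono; lra.
have : expR (m%:R * (kap - d)) <= expR (m%:R * (kap + d)) by apply: mono; lra.
have a0 : 0 <= expR (m%:R * (kap - d)) by exact: expR_ge0.
have := cab m; lra.
Qed.

End ExponentialRate.

Section Growth.
Variables (R : realType) (n : nat) (M : ptopologicalType).
Variables (A : smooth_atlas R n M) (g : riemannian_metric A).
Variable e : separating_family g.
Variable f : M -> M.

Lemma fnormD y (v w : 'rV[R]_n) : fnorm e y (v + w) <= fnorm e y v + fnorm e y w.
Proof.
rewrite /fnorm -big_split /=; apply: ler_sum => i _.
by rewrite /dfun linearD; exact: ler_normD.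
Qed.

Lemma fnorm_ge0 y (v : 'rV[R]_n) : 0 <= fnorm e y v.
Proof. exact: sumr_ge0. Qed.

Lemma fnormN y (v : 'rV[R]_n) : fnorm e y (- v) = fnorm e y v.
Proof. by apply: eq_bigr => i _; rewrite /dfun linearN normrN. Qed.

Lemma fnorm_tnorm : exists2 c : R, 0 < c & forall y w,
  tnorm g y w <= c * fnorm e y w /\ fnorm e y w <= c * tnorm g y w.
Proof.
have s0 := sf_cst_gt0 e.
exists (sf_cst e * #|sf_idx e|.+1%:R); first by rewrite mulr_gt0.
move=> y w; split.
  apply: (le_trans (@sf_diff_ge _ _ _ _ _ e y w)).
  rewrite ler_wpM2r ?fnorm_ge0// ler_peMr ?(ltW s0)//.
  by rewrite -[leLHS]/(1%:R) ler_nat.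
rewrite /fnorm; apply: (@le_trans _ _ (\sum_(i : sf_idx e) sf_cst e * tnorm g y w)).
  by apply: ler_sum => i _; exact: sf_diff_le.
rewrite sumr_const -[leLHS]mulr_natl mulrA [_ * sf_cst e]mulrC.
rewrite ler_wpM2r ?tnorm_ge0// ler_pM2l// ler_nat; exact: leqnSn.
Qed.

(** Since the exponents increase strictly, the last nonzero component of a vector dominates. Every
    nonzero vector thus grows at some rate [lam i], at least [lam 0], and one [b] serves all
    vectors. *)
Lemma growth_of_splitting x (k : nat) (E : nat -> 'M[R]_n) (lam : nat -> R) :
  (\sum_(i < k) E i :=: (1%:M : 'M[R]_n))%MS ->
  (forall i j, (i < j)%N -> (j < k)%N -> lam i < lam j) ->
  (forall i, (i < k)%N -> 0 < lam i) ->
  (forall i (v : 'rV[R]_n), (i < k)%N -> v != 0 -> (v <= E i)%MS ->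
    (fun m : nat => m%:R^-1 * ln (tnorm g (iter m f x) (v *m tangent_map A (iter m f) x)))
      @ \oo --> lam i) ->
  exists2 b : R, 1 < b & forall v : 'rV[R]_n, v != 0 -> forall n0, exists2 m, (n0 <= m)%N &
    b ^+ m < fnorm e (iter m f x) (v *m tangent_map A (iter m f) x).
Proof.
move=> sumE lam_lt lam0 lamE.
pose a v m := fnorm e (iter m f x) (v *m tangent_map A (iter m f) x).
have [c c0 Hc] := fnorm_tnorm.
have rE i v : (i < k)%N -> v != 0 -> (v <= E i)%MS -> exp_rate (a v) (lam i).
  move=> ik v0 vE.
  apply: exp_rate_comparable c0 _ _ (exp_rate_lim (lam0 _ ik) (lamE i v ik v0 vE)).
    by move=> m; have [] := Hc (iter m f x) (v *m tangent_map A (iter m f) x).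
  by move=> m; have [] := Hc (iter m f x) (v *m tangent_map A (iter m f) x).
have Q j : (j <= k)%N -> forall v : nat -> 'rV[R]_n,
    (forall i, (i < j)%N -> (v i <= E i)%MS) ->
    \sum_(i < j) v i = 0 \/ exists2 i, (i < j)%N & exp_rate (a (\sum_(i < j) v i)) (lam i).
  elim: j => [|j IH] jk v vE; first by left; rewrite big_ord0.
  rewrite big_ord_recr /=.
  have [|z0|[i ij ri]] := IH (ltnW jk) v; first by move=> i ij; apply: vE; exact: ltnW.
    rewrite z0 add0r; have [->|vj0] := eqVneq (v j) 0; first by left.
    by right; exists j => //; apply: rE => //; exact: vE.
  right; have [->|vj0] := eqVneq (v j) 0.
    by rewrite addr0; exists i => //; exact: ltnW.
  exists j => //.
  apply: exp_rate_dominant (lam_lt _ _ ij jk) _ _ ri (rE _ _ jk vj0 (vE j (ltnSn j))).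
    by move=> m; rewrite /a mulmxDl; exact: fnormD.
  move=> m; rewrite /a mulmxDl.
  set p := _ *m _; set q := _ *m _.
  have {1}-> : p = - q + (q + p) by rewrite addKr.
  by apply: (le_trans (fnormD _ _ _)); rewrite fnormN.
case: k sumE lam_lt lam0 lamE rE Q => [|k] sumE lam_lt lam0 lamE rE Q.
  (* An empty family spans the tangent space only if that space is zero; there is no nonzero vector
     and any b will do. *)
  exists 2; first by rewrite ltr1n.
  move=> v /negP[]; have : (v <= \sum_(i < 0) E i)%MS by rewrite sumE submx1.
  by rewrite big_ord0 submx0.
have l0 := lam0 0%N isT.
(* With tolerance [lam 0 / 4] the growth rate stays at least [3 / 4 * lam 0], strictly above the
   exponent [lam 0 / 2] of b. *)
exists (expR (lam 0%N / 2)); first by rewrite expR_gt1 divr_gt0.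
move=> v v0 n0.
have /sub_sumsmxP[w vw] : (v <= \sum_(i < k.+1) E i)%MS by rewrite sumE submx1.
pose w' i := if insub i is Some i' then w i' *m E i else 0.
have w'E (i : 'I_k.+1) : w' i = w i *m E i by rewrite /w' valK.
have vw' : v = \sum_(i < k.+1) w' i by rewrite vw; apply: eq_bigr => i _; rewrite w'E.
have [|z0|[i ik ri]] := Q k.+1 (leqnn _) w'.
- by move=> i ik; rewrite (w'E (Ordinal ik)) submxMl.
- by move: v0; rewrite vw' z0 eqxx.
rewrite -vw' in ri.
have li : lam 0%N <= lam i.
  by case: i ik {ri} => [//|i ik]; apply/ltW/lam_lt.
have e0 : 0 < lam 0%N / 4 by rewrite divr_gt0.
near \oo => m.
exists m; first by near: m; exact: nbhs_infty_ge.
have m0 : (0 < m)%N by near: m; exact: nbhs_infty_gt.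
have : expR (m%:R * (lam i - lam 0%N / 4)) <= a v m.
  have : expR (m%:R * (lam i - lam 0%N / 4)) <= a v m <= expR (m%:R * (lam i + lam 0%N / 4)).
    by near: m; exact: ri.
  by case/andP.
apply: lt_le_trans; rewrite -expRM_natl ltr_expR ltr_pM2l ?ltr0n//.
by lra.
Unshelve. all: by end_near. Qed.

End Growth.

(** * Ergodic theory *)

Section Ergodic.
Variables (R : realType) (d : measure_display) (T : measurableType d).
Variables (mu : probability T R) (f : T -> T).
Hypothesis mf : forall B : set T, measurable B -> measurable (f @^-1` B).
Hypothesis mu_inv : forall B : set T, measurable B -> mu (f @^-1` B) = mu B.
Hypothesis mu_erg : forall B : set T, measurable B -> f @^-1` B = B ->
  mu B = 0%E \/ mu B = 1%E.

Lemma iter_preimage_measurable m (B : set T) : measurable B ->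
  measurable (iter m f @^-1` B).
Proof.
by move=> mB; elim: m => [//|m IH]; rewrite (_ : _ @^-1` _ = iter m f @^-1` (f @^-1` B))//;
  elim: m B mB {IH} => [|m IH] B mB; [exact: mf|exact: (IH _ (mf mB))].
Qed.

Lemma iter_preimage_measure m (B : set T) : measurable B ->
  mu (iter m f @^-1` B) = mu B.
Proof.
elim: m B => [//|m IH] B mB.
have -> : iter m.+1 f @^-1` B = iter m f @^-1` (f @^-1` B) by [].
by rewrite IH ?mu_inv//; exact: mf.
Qed.

Lemma ergodic_invariant_gt0 (B : set T) : measurable B -> f @^-1` B = B ->
  (0 < mu B)%E -> mu B = 1%E.
Proof. by move=> mB fB; case: (mu_erg mB fB) => // ->; rewrite ltxx. Qed.

(* The decreasing intersection of the preimages of W is invariant and has the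
   measure of W. *)
Lemma ergodic_backward_gt0 (W : set T) : measurable W -> f @^-1` W `<=` W ->
  (0 < mu W)%E -> mu W = 1%E.
Proof.
move=> mW fW W0; pose F m := iter m f @^-1` W.
have mF m : measurable (F m) by exact: iter_preimage_measurable.
have mZ : measurable (\bigcap_m F m) by apply: bigcap_measurable => // m _; exact: mF.
have decF : {homo F : p q / (p <= q)%N >-> (q <= p)%O}.
  apply/nonincreasing_seqP => m; apply/subsetPset => x.
  by rewrite /F /= => /fW.
have Z : mu (\bigcap_m F m) = mu W.
  have F0 : (mu (F 0%N) < +oo)%E by rewrite ltey_eq fin_num_measure.
  have c1 := nonincreasing_cvg_mu F0 mF mZ decF.
  have c2 : (mu \o F) m @[m --> \oo] --> mu W.
    rewrite (_ : mu \o F = cst (mu W)); first exact: cvg_cst.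
    by apply/funext => m; exact: iter_preimage_measure.
  exact: (cvg_unique _ c1 c2).
rewrite -Z; apply: ergodic_invariant_gt0 => //; last by rewrite Z.
apply/seteqP; split=> x Hx m _; last first.
  by have := Hx m.+1 I; rewrite /F /= -iterSr.
case: m => [|m]; last by have := Hx m I; rewrite /F /= -iterSr.
by apply: fW; exact: (Hx 0%N I).
Qed.

Definition visits (B : set T) (m : nat) (x : T) : nat :=
  \sum_(j < m) `[< B (iter j f x) >].

Lemma visits_shift B m x : visits B m.+1 x = (`[< B x >] + visits B m (f x))%N.
Proof.
rewrite /visits big_ord_recl /=; congr (_ + _)%N.
by apply: eq_bigr => i _; rewrite add0n -iterS iterSr.
Qed.

Lemma visits_indic B m x :
  (visits B m x)%:R = \sum_(j < m) \1_(iter j f @^-1` B) x :> R.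
Proof.
by rewrite /visits natr_sum; apply: eq_bigr => j _; rewrite indicE.
Qed.

Lemma visits_measurable B m : measurable B ->
  measurable_fun [set: T] (fun x => (visits B m x)%:R : R).
Proof.
move=> mB; under eq_fun do rewrite visits_indic.
by apply: measurable_sum => j; apply: measurable_indic; exact: iter_preimage_measurable.
Qed.

Lemma visits_le_measurable B m q c : measurable B ->
  measurable [set x | (q * visits B m x <= c)%N].
Proof.
move=> mB; have H : measurable_fun [set: T] (fun x => q%:R * (visits B m x)%:R : R).
  by apply: measurable_funM => //; exact: visits_measurable.
have := H measurableT [set` `]-oo, (c%:R : R)]] (measurable_itv _).
rewrite setTI; congr measurable; apply/seteqP; split=> x /=.
  by rewrite in_itv /= -natrM ler_nat.
by rewrite in_itv /= -natrM ler_nat.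
Qed.

Lemma visits_integral B m : measurable B ->
  (\int[mu]_(x in [set: T]) ((visits B m x)%:R : R)%:E = m%:R%:E * mu B)%E.
Proof.
move=> mB.
have E x : ((visits B m x)%:R : R)%:E = (\sum_(j < m) (\1_(iter j f @^-1` B) x)%:E)%E.
  by rewrite visits_indic sumEFin.
under eq_integral do rewrite E.
have mi j : measurable_fun [set: T] (fun x => (\1_(iter j f @^-1` B) x : R)%:E).
  by apply/measurable_EFinP; apply: measurable_indic; exact: iter_preimage_measurable.
rewrite (ge0_integral_sum mu measurableT (fun j : 'I_m => mi j)); last first.
  by move=> j x _; rewrite lee_fin.
rewrite (eq_bigr (fun=> mu B)); last first.
  move=> j _; rewrite integral_indic//; last exact: iter_preimage_measurable.
  by rewrite setIT; exact: iter_preimage_measure.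
by rewrite sumr_const card_ord mule_natl.
Qed.

Lemma visits_markov B m q : measurable B ->
  (m%:R%:E * mu [set x | (m < q * visits B m x)%N] <= q%:R%:E * (m%:R%:E * mu B))%E.
Proof.
move=> mB; set A := [set x | _].
have mA : measurable A.
  rewrite (_ : A = ~` [set x | (q * visits B m x <= m)%N]).
    by apply: measurableC; exact: visits_le_measurable.
  by apply/seteqP; split=> x /=; rewrite /A /= ltnNge => /negP.
have mv : measurable_fun [set: T] (fun x => ((visits B m x)%:R : R)%:E).
  by apply/measurable_EFinP; exact: visits_measurable.
have m1A : measurable_fun [set: T] (fun x => (\1_A x : R)%:E).
  by apply/measurable_EFinP; exact: measurable_indic.
have -> : (m%:R%:E * mu A = \int[mu]_(x in [set: T]) (m%:R%:E * (\1_A x : R)%:E))%E.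
  rewrite ge0_integralZl_EFin ?ler0n// integral_indic// setIT.
  by [].
rewrite -(visits_integral m mB) -ge0_integralZl_EFin ?ler0n//.
apply: ge0_le_integral => //.
- exact: measurable_funeM.
- exact: measurable_funeM.
- move=> x _; rewrite -!EFinM lee_fin indicE -natrM.
  rewrite -natrM ler_nat; case: (boolP (x \in A)) => [|_]; last by rewrite muln0.
  by rewrite inE /A /= muln1 => /ltnW.
Qed.

(* The additive constant c makes the set of such points invariant, so by
   ergodicity it is enough that it has measure at least 1/2. *)
Lemma ergodic_rare_visits (B : set T) (q : nat) : measurable B -> (0 < q)%N ->
  (q%:R%:E * mu B <= (2^-1)%:E)%E ->
  exists2 Y : set T, measurable Y /\ mu Y = 1%E & forall x, Y x ->
    exists c, forall n0, exists2 m, (n0 <= m)%N & (q * visits B m x <= m + c)%N.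
Proof.
move=> mB q0 qB.
pose Y := \bigcup_c \bigcap_n0 \bigcup_k [set x | (q * visits B (n0 + k) x <= n0 + k + c)%N].
have mY : measurable Y.
  apply: bigcup_measurable => c _; apply: bigcap_measurable => // n0 _.
  by apply: bigcup_measurable => k _; exact: visits_le_measurable.
exists Y; last first.
  by move=> x [c _ H]; exists c => n0; have [k _ hk] := H n0 I; exists (n0 + k)%N; rewrite ?leq_addr.
split=> //; apply: ergodic_invariant_gt0 => //.
  (* Prepending a point adds at most one visit, hence at most [q], to the left side; dropping it
     shortens the time by one. *)
  apply/seteqP; split=> x [c _ H].
  - exists (c + q)%N => // n0 _; have [k _ /= hk] := H n0 I.
    exists k.+1 => //=; rewrite addnS visits_shift mulnDr.
    have : (q * `[< B x >] <= q)%N by case: asboolP => _; rewrite ?muln1 ?muln0.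
    by lia.
  - exists c.+1 => // n0 _; have [k _ /= hk] := H n0.+1 I.
    exists k => //=; move: hk; rewrite addSn visits_shift mulnDr.
    by lia.
pose A m := [set x | (m < q * visits B m x)%N].
have mA m : measurable (A m).
  rewrite /A (_ : [set x | _] = ~` [set x | (q * visits B m x <= m)%N]).
    by apply: measurableC; exact: visits_le_measurable.
  by apply/seteqP; split=> x /=; rewrite ltnNge => /negP.
have A2 m : (0 < m)%N -> (mu (A m) <= (2^-1)%:E)%E.
  move=> m0; have m0' : 0 < m%:R :> R by rewrite ltr0n.
  rewrite -(@lee_pmul2l _ m%:R%:E) ?lte_fin//; apply: (le_trans (visits_markov m q mB)).
  by rewrite muleCA; apply: lee_wpmul2l => //; rewrite lee_fin ler0n.
(* The points with too many visits at every time after [n0]. Each [C n0] lies in one [A m] with m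
   positive, so it has measure at most 1/2, and so has the increasing union, which contains the
   complement of [Y]. *)
pose C n0 := \bigcap_k A (n0.+1 + k)%N.
have mC n0 : measurable (C n0) by apply: bigcap_measurable.
have mU : measurable (\bigcup_n0 C n0) by apply: bigcup_measurable.
have incC : {homo C : p q / (p <= q)%N >-> (p <= q)%O}.
  move=> p p' pp'; apply/subsetPset => x H k _.
  have := H (p' - p + k)%N I; congr (A _ x); lia.
have U2 : (mu (\bigcup_n0 C n0) <= (2^-1)%:E)%E.
  have cv := nondecreasing_cvg_mu (mu := mu) mC mU incC.
  rewrite -(cvg_lim _ cv)//; apply: lime_le; first by apply/cvg_ex; eexists; exact: cv.
  apply: nearW => n0 /=; apply: le_trans (A2 n0.+1 isT).
  apply: le_measure; rewrite ?inE//.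
  by move=> x /(_ 0%N I); rewrite addn0.
have YU : ~` Y `<=` \bigcup_n0 C n0.
  move=> x; apply: contra_notP => nU; exists 0%N => // n0 _.
  apply: contrapT => h; apply: nU; exists n0 => // k _.
  rewrite /A /= ltnNge; apply/negP => hk; apply: h; exists k.+1 => //=.
  by rewrite addn0 addnS.
have Yc : (mu (~` Y) <= (2^-1)%:E)%E.
  by apply: le_trans U2; apply: le_measure; rewrite ?inE//; exact: measurableC.
rewrite lt_neqAle measure_ge0 andbT eq_sym; apply/eqP => Y0.
by move: Yc; rewrite probability_setC// Y0 sube0 lee_fin leNgt invf_lt1 ?ltr1n.
Qed.

End Ergodic.

(** * Growth along sequences with few bad steps *)

Section Counting.
Variable R : realType.

(* Invariant: after [t] steps of which [S t] were bad, [D] has grown by at least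
   [c ^ t / (L * c) ^ S t]; good steps come in blocks of length at most [K]. *)
Lemma rare_bad_steps_unbounded (D : nat -> R) (bad : nat -> bool) (L c : R)
    (K q a : nat) :
  1 < c -> 1 <= L -> 2 * (L * c) <= c ^+ q ->
  (forall j, 0 <= D j) -> 0 < D 0%N -> (forall j, D j <= 1) ->
  (forall j, bad j -> D j <= L * D j.+1) ->
  (forall j, ~~ bad j -> exists2 m, (0 < m <= K)%N & c ^+ m * D j <= D (j + m)%N) ->
  ~ (forall n0, exists2 m, (n0 <= m)%N & (q * \sum_(j < m) bad j <= m + a)%N).
Proof.
move=> c1 L1 cq D0 D00 D1 Hbad Hgood rare.
pose S m := (\sum_(j < m) bad j)%N.
have SS m : S m.+1 = (S m + bad m)%N by rewrite /S big_ord_recr.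
have SD m k : (S m <= S (m + k) <= S m + k)%N.
  elim: k => [|k IH]; first by rewrite !addn0 leqnn.
  by rewrite addnS SS; move: (bad _) => [] /=; lia.
have c0 : 0 < c by exact: lt_trans c1.
have L0 : 0 < L by exact: lt_le_trans L1.
have Lc1 : 1 <= L * c by rewrite mulr_ege1// ltW.
have Lc0 : 0 < L * c by rewrite mulr_gt0.
have claim N : exists2 t, (N <= t <= N + K)%N & D 0%N * c ^+ t <= D t * (L * c) ^+ S t.
  elim: N => [|N [t tN Ht]].
    by exists 0%N => //; rewrite /S big_ord0 !expr0.
  have [tN'|Nt] := ltnP N t; first by exists t => //; move: tN tN'; clear; lia.
  have {Nt}tN : t = N by move: tN Nt; clear; lia.
  rewrite {}tN in Ht.
  have [bN|gN] := boolP (bad N).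
    exists N.+1; first by clear; lia.
    rewrite SS bN addn1 exprS mulrCA; apply: (le_trans (ler_wpM2l (ltW c0) Ht)).
    have -> : D N.+1 * (L * c) ^+ (S N).+1 = c * ((L * D N.+1) * (L * c) ^+ S N).
      by rewrite exprS; ring.
    by rewrite ler_wpM2l ?ler_wpM2r ?exprn_ge0 ?Hbad ?(ltW Lc0)// ltW.
  have [m mK Hm] := Hgood N gN.
  exists (N + m)%N; first by move: mK; clear; lia.
  rewrite exprD mulrA; apply: (le_trans (ler_wpM2r _ Ht)).
    by rewrite exprn_ge0// ltW.
  rewrite mulrAC mulrC [D N * _]mulrC; apply: (@le_trans _ _ ((L * c) ^+ S N * D (N + m)%N)).
    by rewrite ler_wpM2l// exprn_ge0// ltW.
  rewrite mulrC ler_wpM2l// ler_weXn2l//.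
  by have /andP[] := SD N m.
(* At a time N with few bad steps, [D 0 * c ^+ N] is at most [(L * c) ^+ (S N + K)]. In the q-th
   power the left side gains [(2 * (L * c)) ^+ N] and [q * S N] is at most [N + a], so the powers
   [(L * c) ^+ N] cancel and [2 ^+ N] stays bounded, which is absurd. *)
have bound n0 : D 0%N ^+ q * 2 ^+ n0 <= (L * c) ^+ (a + q * K).
  have [N n0N qN] := rare n0.
  have [t tN Ht] := claim N.
  have le1 : D 0%N * c ^+ N <= (L * c) ^+ (S N + K).
    apply: (@le_trans _ _ (D 0%N * c ^+ t)).
      by rewrite ler_wpM2l// ler_weXn2l ?(ltW c1)//; move/andP : tN => [].
    apply: (le_trans Ht); apply: (@le_trans _ _ ((L * c) ^+ S t)).
      by rewrite ler_piMl ?exprn_ge0 ?(ltW Lc0).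
    rewrite ler_weXn2l//.
    have := SD N (t - N)%N; move/andP : tN => [h1 h2]; rewrite subnKC// => /andP[_].
    by move: h1 h2; clear; lia.
  have le2 : D 0%N ^+ q * (2 * (L * c)) ^+ N <= (L * c) ^+ (N + a + q * K).
    apply: (@le_trans _ _ ((D 0%N * c ^+ N) ^+ q)).
      rewrite [leRHS]exprMn [in leRHS]exprAC ler_wpM2l ?exprn_ge0//.
      by rewrite lerXn2r ?nnegrE ?exprn_ge0 ?mulr_ge0// ltW.
    apply: (@le_trans _ _ (((L * c) ^+ (S N + K)) ^+ q)).
      by rewrite lerXn2r ?nnegrE ?exprn_ge0 ?mulr_ge0 ?exprn_ge0// ltW.
    rewrite -exprM ler_weXn2l// mulnDl [(K * q)%N]mulnC leq_add2r.
    by rewrite mulnC.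
  apply: (@le_trans _ _ (D 0%N ^+ q * 2 ^+ N)).
    by rewrite ler_wpM2l ?exprn_ge0// ler_weXn2l// ler1n.
  rewrite -(@ler_pM2r _ ((L * c) ^+ N)) ?exprn_gt0//.
  by rewrite -mulrA -exprMn -exprD addnC addnA.
have Dq0 : 0 < D 0%N ^+ q by rewrite exprn_gt0.
pose z := (L * c) ^+ (a + q * K) / D 0%N ^+ q.
have z0 : 0 <= z by rewrite divr_ge0 ?exprn_ge0 ?ltW.
have := bound (Num.truncn z).+1; apply/negP; rewrite -ltNge -ltr_pdivrMl// mulrC.
apply: (@lt_trans _ _ (Num.truncn z).+1%:R).
  by have /andP[] := truncn_itv z0.
by rewrite -natrX ltr_nat ltn_expl.
Qed.

End Counting.

(** * Sets of expanding points *)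

Section ExpandingSets.
Variables (R : realType) (n : nat) (M : ptopologicalType).
Variables (A : smooth_atlas R n M) (g : riemannian_metric A).
Variable e : separating_family g.
Hypothesis compM : compact [set: M].
Variable f : M -> M.
Hypothesis fC1 : C1_local_diffeo A f.

(** Failure at [x] is witnessed by one [y] through finitely many strict inequalities between
    continuous functions of [x]; the same [y] witnesses it nearby. *)
Lemma expansive_at_closed (b : R) k n0 K : closed [set x | expansive_at e f b k n0 K x].
Proof.
rewrite -[X in closed X]setCK; apply: open_closedC; rewrite openE => x /= /existsNP[y].
move=> /not_implyP[xy H]; rewrite /interior /=.
have cs m : {for x, continuous (fun x' => sdist e (iter m f x') (iter m f y))}.
  apply: sdist_continuous; last exact: cvg_cst.
  by apply: iter_continuous; exact: f_continuous fC1.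
have near1 : \forall x' \near x, sdist e x' y < K.+1%:R^-1.
  exact: cvgr_lt (cs 0%N) _ xy.
have near2 : \forall x' \near x, forall m : 'I_K.+1, (n0 <= m)%N ->
    k.+1%:R * sdist e (iter m f x') (iter m f y) < b ^+ m * sdist e x' y.
  apply: near_forall => m; have [n0m|] := leqP n0 m; last by move=> _; exact: nearW.
  have [hle|hlt] := lerP (b ^+ m * sdist e x y) (k.+1%:R * sdist e (iter m f x) (iter m f y)).
    by case: H; exists m => //; rewrite n0m -ltnS ltn_ord.
  have ch : {for x, continuous (fun x' => b ^+ m * sdist e x' y -
      k.+1%:R * sdist e (iter m f x') (iter m f y))}.
    apply: cvgB; apply: cvgMl_tmp; [exact: (cs 0%N)|exact: cs].
  rewrite -subr_gt0 in hlt.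
  near=> x' => _; rewrite -subr_gt0; near: x'; exact: cvgr_gt ch _ hlt.
near=> x' => /(_ y)[|m /andP[n0m mK]]; first by near: x'.
apply/negP; rewrite -ltNge.
suff H' : forall m : 'I_K.+1, (n0 <= m)%N ->
    k.+1%:R * sdist e (iter m f x') (iter m f y) < b ^+ m * sdist e x' y.
  exact: H' (Ordinal (mK : (m < K.+1)%N)) n0m.
by near: x'.
Unshelve. all: by end_near. Qed.

Definition expanding_set (b : R) : set (borel M) :=
  [set x | exists k, forall n0, exists K, expansive_at e f b k n0 K x].

Lemma expanding_set_measurable b : measurable (expanding_set b).
Proof.
have -> : expanding_set b = \bigcup_k \bigcap_n0 \bigcup_K
    [set x | expansive_at e f b k n0 K x].
  apply/seteqP; split=> x.
    by move=> [k H]; exists k => // n0 _; have [K HK] := H n0; exists K.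
  by move=> [k _ H]; exists k => n0; have [K _ HK] := H n0 I; exists K.
apply: bigcup_measurable => k _; apply: bigcap_measurable => // n0 _.
apply: bigcup_measurable => K _; apply: closed_borel.
exact: expansive_at_closed.
Qed.

Lemma expanding_set_le b b' : 0 <= b' -> b' <= b -> expanding_set b `<=` expanding_set b'.
Proof.
move=> b'0 b'b x [k H]; exists k => n0; have [K HK] := H n0; exists K => y /HK[m mK Hm].
exists m => //; apply: le_trans Hm; rewrite ler_wpM2r ?sdist_ge0// lerXn2r// nnegrE//.
exact: le_trans b'b.
Qed.

Lemma expanding_set_backward b : 0 < b -> f @^-1` expanding_set b `<=` expanding_set b.
Proof.
move=> b0 x [k H].
have [L L0 HL] := inverse_lipschitz e compM fC1.
(* Going from x to [f x] may shrink distances by the factor [L], and the time grows by one, which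
   demands a further factor [b]. *)
pose z : R := b * L%:R * k.+1%:R.
have z0 : 0 <= z by rewrite !mulr_ge0// ltW.
exists (Num.truncn z) => n0; have [K HK] := H n0.
have K0 : (0 : R) < K.+1%:R^-1 by rewrite invr_gt0.
have [d d0 Hd] := nbhs_sdist_ball e compM
  (f_continuous fC1 (sdist_ball_nbhs e (f x) K0)).
(* [K.+1] admits the shifted time, [truncn d^-1] makes [f y] close enough to [f x], and [L] puts [y]
   within the range of the inverse Lipschitz estimate. *)
exists (maxn K.+1 (maxn (Num.truncn d^-1) L)) => y xy.
set K' := maxn _ _ in xy *.
have xyd : sdist e x y < d.
  apply: (lt_le_trans xy); rewrite -[leRHS]invrK lef_pV2 ?posrE ?invr_gt0//.
  apply: (le_trans (ltW (truncnS_gt _))); rewrite ler_nat ltnS.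
  by rewrite /K' !leq_max leqnn orbT.
have xyL : sdist e x y < L%:R^-1.
  apply: (lt_le_trans xy); rewrite lef_pV2 ?posrE ?ltr0n// ler_nat.
  by rewrite leqW// /K' !leq_max leqnn !orbT.
have [m /andP[n0m mK] Hm] := HK _ (Hd _ xyd).
exists m.+1; first by rewrite leqW//= /K' leq_max ltnS mK.
rewrite !iterSr; apply: (@le_trans _ _ (z * sdist e (iter m f (f x)) (iter m f (f y)))).
  apply: (@le_trans _ _ (b ^+ m.+1 * (L%:R * sdist e (f x) (f y)))).
    by rewrite ler_wpM2l ?exprn_ge0 ?(ltW b0)//; exact: HL.
  rewrite [leLHS](_ : _ = b * L%:R * (b ^+ m * sdist e (f x) (f y))); last first.
    by rewrite exprS; ring.
  by rewrite -[leRHS]mulrA ler_wpM2l// mulr_ge0// ltW.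
by rewrite ler_wpM2r ?sdist_ge0// ltW// truncnS_gt.
Qed.

Lemma expansive_at_le (b : R) k n0 K K' x : (K <= K')%N ->
  expansive_at e f b k n0 K x -> expansive_at e f b k n0 K' x.
Proof.
move=> KK' H y xy; have [|m /andP[n0m mK] Hm] := H y.
  by apply: (lt_le_trans xy); rewrite lef_pV2 ?posrE// ler_nat.
by exists m => //; rewrite n0m (leq_trans mK).
Qed.

(** The gain [c ^+ (2 * m)] splits into two factors [c ^+ m]; for times beyond some N one of them
    exceeds the loss [k.+1], and the other remains as gain without loss. *)
Lemma expanding_set_step c : 1 < c -> expanding_set (c ^+ 2) `<=`
  \bigcup_K [set x | expansive_at e f c 0 1 K x].
Proof.
move=> c1 x [k H]; have c0 : 0 < c by exact: lt_trans c1.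
have ci : `|c^-1| < 1 by rewrite ger0_norm ?invr_ge0 ?(ltW c0)// invf_lt1.
have k0 : (0 : R) < k.+1%:R^-1 by rewrite invr_gt0.
have [N _ HN] := cvgr_lt _ (cvg_expr ci) _ k0.
have [K HK] := H N.+1; exists K => // y /HK[m /andP[Nm mK] Hm].
exists m; first by rewrite mK (leq_ltn_trans _ Nm).
rewrite mul1r -(ler_pM2l (exprn_gt0 m c0)) mulrA -exprD addnn -mul2n exprM.
apply: (le_trans Hm); rewrite ler_wpM2r ?sdist_ge0//.
rewrite -lef_pV2 ?posrE ?exprn_gt0// -exprVn; apply: ltW.
by apply: HN => /=; exact: ltnW.
Qed.

End ExpandingSets.

(** * Separation of orbits and conclusion *)

Section Conclusion.
Variables (R : realType) (n : nat) (M : ptopologicalType).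
Variables (A : smooth_atlas R n M) (g : riemannian_metric A).
Variables (e : separating_family g) (f : M -> M) (mu : probability (borel M) R).
Hypothesis compM : compact [set: M].
Hypothesis fC1 : C1_local_diffeo A f.
Hypothesis mu_inv : invariant_measure mu f.
Hypothesis mu_erg : ergodic mu f.
Hypothesis mu_pos : lyapunov_exponents_positive g mu f.

(** The rate of expansion depends on the point, but almost every point belongs to one of countably
    many [W j], with rates decreasing to 1, so these are not all null. *)
Lemma expanding_set_gt0 : exists2 c : R, 1 < c & (0 < mu (expanding_set e f (c ^+ 2)))%E.
Proof.
pose c j : R := 1 + j.+1%:R^-1.
have c1 j : 1 < c j by rewrite ltrDl.
pose W j := expanding_set e f (c j ^+ 2).
have mW j : measurable (W j) by exact: expanding_set_measurable.
apply: contrapT => H.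
have W0 j : mu.-negligible (W j).
  apply/negligibleP => //; apply/eqP; rewrite eq_le measure_ge0 andbT leNgt.
  by apply/negP => Wj; apply: H; exists (c j).
have [k [E [lam [[S [mS S1] [HS _]] [Z [mZ Z0 HZ]]]]]] := mu_pos.
have SC : mu.-negligible (~` S).
  apply/negligibleP; first exact: measurableC.
  by apply: (etrans (probability_setC mu mS)); rewrite S1 subee.
have ZN : mu.-negligible Z by apply/negligibleP.
have := negligibleU (negligibleU SC ZN) (negligible_bigcup W0).
have -> : ~` S `|` Z `|` \bigcup_j W j = setT.
  apply/seteqP; split=> // x _; have [Sx|nS] := pselect (S x); last by left; left.
  have [Zx|nZ] := pselect (Z x); first by left; right.
  right; have posx : forall i, (i < k x)%N -> 0 < lam x i.
    by apply: contrapT => hx; apply: nZ; exact: HZ.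
  have [[span _] _ _ incr lim] := HS x Sx.
  have [b b1 Hb] := growth_of_splitting e span incr posx lim.
  have [m Hm] := expansion_from_growth compM fC1 (ltW b1) Hb.
  (* For t between 0 and 1, [(1 + t) ^+ 2] is at most [1 + 3 * t], so t at most [(b - 1) / 3] brings
     the square below b. *)
  have d0 : 0 < (b - 1) / 3 by rewrite divr_gt0// subr_gt0.
  pose j := Num.truncn ((b - 1) / 3)^-1.
  have hj : j.+1%:R^-1 <= (b - 1) / 3.
    rewrite -[leRHS]invrK lef_pV2 ?posrE ?invr_gt0//.
    exact/ltW/truncnS_gt.
  exists j => //; apply: (@expanding_set_le _ _ _ _ _ _ _ b).
  - by rewrite exprn_ge0// ltW// (lt_trans _ (c1 j)).
  - have i0 : 0 <= j.+1%:R^-1 :> R by [].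
    have i1 : j.+1%:R^-1 <= 1 :> R by rewrite invf_le1// ler1n.
    by rewrite /c; move: (j.+1%:R^-1) i0 i1 hj => t; nra.
  - by exists m.
move/(@negligibleP _ _ _ mu) => /(_ measurableT) mu0.
by have /eqP := etrans (esym mu0) (probability_setT mu); rewrite eq_sym onee_eq0.
Qed.

Lemma uniform_step_measure (c : R) (q : nat) : 1 < c ->
  (0 < mu (expanding_set e f (c ^+ 2)))%E -> (0 < q)%N ->
  exists K, (q%:R%:E * mu (~` [set x | expansive_at e f c 0 1 K x]) <= (2^-1)%:E)%E.
Proof.
move=> c1 W0 q0; pose G K : set (borel M) := [set x | expansive_at e f c 0 1 K x].
have c20 : 0 < c ^+ 2 by rewrite exprn_gt0// (lt_trans _ c1).
have mG K : measurable (G K) by apply: closed_borel; exact: expansive_at_closed.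
have mUG : measurable (\bigcup_K G K) by exact: bigcup_measurable.
have UG1 : mu (\bigcup_K G K) = 1%E.
  apply/eqP; rewrite eq_le; apply/andP; split; first exact: probability_le1.
  have <- : mu (expanding_set e f (c ^+ 2)) = 1%E.
    apply: (ergodic_backward_gt0 (continuous_borel (f_continuous fC1)) mu_inv mu_erg) W0.
      exact: expanding_set_measurable.
    exact: expanding_set_backward.
  apply: le_measure; rewrite ?inE//; first exact: expanding_set_measurable.
  exact: expanding_set_step.
have cvG : mu \o G @ \oo --> 1%:E.
  rewrite -UG1; apply: nondecreasing_cvg_mu => // K K' KK'.
  by apply/subsetPset => x; exact: expansive_at_le.
have [_ cvG'] := (fine_cvgP _ _).1 cvG.
have h1 : 1 - (2 * q%:R)^-1 < 1 :> R by rewrite ltrBlDr ltrDl invr_gt0 mulr_gt0 ?ltr0n.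
have [K _ HK] := cvgr_gt _ cvG' _ h1.
have {}HK := HK K (leqnn K); exists K.
have -> : mu (~` [set x | expansive_at e f c 0 1 K x]) = (1 - mu (G K))%E.
  exact: (probability_setC mu (mG K)).
have fG : mu (G K) \is a fin_num by exact: fin_num_measure.
rewrite -(fineK fG) -EFinB -EFinM lee_fin.
have q0' : (0 : R) < q%:R by rewrite ltr0n.
rewrite -ler_pdivlMl// -invfM mulrC.
by move: HK => /=; lra.
Qed.

Lemma separated_orbits : exists2 d : R, 0 < d & exists2 Y : set (borel M),
  measurable Y /\ mu Y = 1%E &
  forall x y, Y x -> (forall m, sdist e (iter m f x) (iter m f y) < d) -> x = y.
Proof.
have [c c1 Wc] := expanding_set_gt0.
have c0 : 0 < c by exact: lt_trans c1.
have [L L0 HL] := inverse_lipschitz e compM fC1.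
have ci : `|c^-1| < 1 by rewrite ger0_norm ?invr_ge0 ?(ltW c0)// invf_lt1.
have Lc0 : 0 < (2 * (L%:R * c))^-1 by rewrite invr_gt0 !mulr_gt0 ?ltr0n.
(* A bad visit is charged the factor [L * c]; [q.+1] is a number of good steps whose gain is at
   least twice that charge. *)
have [q _ Hq] := cvgr_lt _ (cvg_expr ci) _ Lc0.
have {}Hq : 2 * (L%:R * c) <= c ^+ q.+1.
  rewrite -lef_pV2 ?posrE ?exprn_gt0// -?exprVn; last by rewrite -invr_gt0.
  by apply: ltW; exact: Hq (leqnSn q).
have [K HK] := uniform_step_measure c1 Wc (ltn0Sn q).
have mB : measurable (~` [set x | expansive_at e f c 0 1 K x] : set (borel M)).
  by apply: open_borel; apply: closed_openC; exact: expansive_at_closed.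
have [Y mY HY] := ergodic_rare_visits
  (continuous_borel (f_continuous fC1)) mu_inv mu_erg mB (ltn0Sn q) HK.
have LK0 : (0 : R) < (maxn L K.+1)%:R by rewrite ltr0n leq_max L0.
(* Closeness [1 / L] makes the inverse Lipschitz bound available at bad times, closeness [1 / K.+1]
   the expansion at good times; both keep the distance below 1. *)
exists (maxn L K.+1)%:R^-1; first by rewrite invr_gt0.
exists Y => // x y Yx close; apply: contrapT => xy.
have dL : (maxn L K.+1)%:R^-1 <= L%:R^-1 :> R.
  by rewrite lef_pV2 ?posrE ?LK0 ?ltr0n// ler_nat leq_maxl.
have dK : (maxn L K.+1)%:R^-1 <= K.+1%:R^-1 :> R.
  by rewrite lef_pV2 ?posrE// ler_nat leq_maxr.
have [a Ha] := HY x Yx.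
apply: (@rare_bad_steps_unbounded R (fun m => sdist e (iter m f x) (iter m f y))
  (fun m => `[< (~` [set x | expansive_at e f c 0 1 K x]) (iter m f x) >])
  L%:R c K q.+1 a) => //=.
- by rewrite ler1n.
- by move=> j; exact: sdist_ge0.
- exact: sdist_gt0.
- move=> j; apply: (le_trans (ltW (close j))); apply: (le_trans dK).
  by rewrite invf_le1// ler1n.
- by move=> j _; apply: HL; exact: lt_le_trans (close j) dL.
- move=> j /asboolPn /contrapT Gj.
  have [m mK Hm] := Gj _ (lt_le_trans (close j) dK).
  by exists m => //; rewrite addnC !iterD; move: Hm; rewrite mul1r.
Qed.

End Conclusion.

Theorem theorem1 (R : realType) (n : nat) (M : ptopologicalType)
  (A : smooth_atlas R n M) (g : riemannian_metric A)
  (f : M -> M) (mu : probability (borel M) R) :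
  hausdorff_space M -> compact [set: M] ->
  C1_local_diffeo A f ->
  ~ atomic mu ->
  invariant_measure mu f ->
  ergodic mu f ->
  lyapunov_exponents_positive g mu f ->
  positively_expansive g mu f.
Proof.
move=> hausM compM fC1 non_atomic mu_inv mu_erg mu_pos.
have [e _] := separating_family_exists g hausM compM.
have [d d0 [Y [mY Y1] HY]] := separated_orbits e compM fC1 mu_inv mu_erg mu_pos.
pose b : R := #|sf_idx e|%:R * sf_cst e + 1.
have b0 : 0 < b by rewrite ltr_wpDl// mulr_ge0// ltW// sf_cst_gt0.
(* Two points of the same [Gamma_plus] have orbits within [d / 4] of that of the centre for [sdist],
   hence within [d / 2] of each other. *)
exists (d / (4 * b)); first by rewrite divr_gt0// mulr_gt0.
move=> x; set Gx := Gamma_plus _ _ _ _.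
have mGx : measurable (Gx : set (borel M)).
  by apply: (Gamma_plus_measurable e); exact: f_continuous fC1.
have [[z [Gz Yz]]|disj] := pselect (exists z, Gx z /\ Y z); last first.
  apply/eqP; rewrite eq_le measure_ge0 andbT.
  have <- : mu (~` Y) = 0%E by apply: (etrans (probability_setC mu mY)); rewrite Y1 subee.
  apply: le_measure; rewrite ?inE//; first exact: measurableC.
  by move=> y Gy Yy; apply: disj; exists y.
have mz : measurable ([set z] : set (borel M)).
  by apply: closed_borel; apply: accessible_closed_set1; exact: hausdorff_accessible.
have <- : mu [set z] = 0%E.
  apply/eqP; rewrite eq_le measure_ge0 andbT leNgt.
  by apply/negP => z0; apply: non_atomic; exists z.
(* Separation is applied at [z], which lies in [Y]; neither the centre x nor the other point y has
   to. *)
congr (mu _); apply/seteqP; split=> [y Gy|_ -> //]; apply/esym/HY => // m.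
have hz := Gamma_plus_sdist e Gz m; have hy := Gamma_plus_sdist e Gy m.
apply: (le_lt_trans (sdist_triangle e (iter m f x) _ _)); rewrite sdistC.
apply: (le_lt_trans (lerD hz hy)); rewrite -/b.
have -> : b * (d / (4 * b)) = d / 4 by field; rewrite gt_eqF.
lra.
Qed.
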